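(* Let $\bar L:G\times\mathfrak g\to\mathbb R$ be a Lagrangian on the right-trivialized tangent bundle $TG\simeq G\times\mathfrak g$ (written $G\circledS\mathfrak g$ when endowed with its semidirect product group structure). Then $\bar L$ defines the trivialized Euler-Lagrange dynamics $$\frac{d}{dt}\frac{\delta\bar L}{\delta\xi}=T_e^*R_g\frac{\delta\bar L}{\delta g}+ad_\xi^*\frac{\delta\bar L}{\delta\xi}.$$ That is, a curve $g(t)$ in $G$, with $\xi(t)=T_{g}R_{g^{-1}}\dot g(t)$, is stationary for the action $\int_a^b\bar L(g(t),\xi(t))\,dt$ under variations $\delta g$ of the curve vanishing at the end points if and only if this equation holds along $(g(t),\xi(t))$.
   Context: $G$ is a Lie group with identity $e$, and $\mathfrak g\simeq T_eG$ is its Lie algebra, assumed reflexive, with dual $\mathfrak g^*$. $R_g$ denotes right multiplication, and $X^G_\xi(g)=T_eR_g\xi$ is the right invariant vector field generated by $\xi\in\mathfrak g$. The bracket on $\mathfrak g$ is the one of right invariant vector fields, $X^G_{[\xi,\eta]}=[X^G_\xi,X^G_\eta]_{JL}$ (Jacobi-Lie bracket of vector fields); equivalently $[\xi,\eta]=ad_\xi\eta$ is the derivative at $e$ in the direction $\xi$ of the right adjoint action $Ad_g=T_e(L_{g^{-1}}\circ R_g)$. $ad^*_\xi$ is the linear dual of $ad_\xi$: $\langle ad^*_\xi\mu,\eta\rangle=\langle\mu,[\xi,\eta]\rangle$. $T_e^*R_g:T_g^*G\to\mathfrak g^*$ is the dual of $T_eR_g$: $\langle T_e^*R_g\alpha,\xi\rangle=\langle\alpha,T_eR_g\xi\rangle$.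 The right trivialization of $TG$ sends $U_g\in T_gG$ to $(g,T_gR_{g^{-1}}U_g)\in G\times\mathfrak g$. $\delta\bar L/\delta g\in T_g^*G$ and $\delta\bar L/\delta\xi\in\mathfrak g^*$ are the partial derivatives of $\bar L(g,\xi)$. With $\eta=T_gR_{g^{-1}}\delta g$, the induced variations of $\xi$ are $\delta\xi=\dot\eta+[\xi,\eta]$ (reduced variational principle). All functions and curves are smooth. *)

(* Defs.v *)
From HB Require Import structures.
From mathcomp Require Import all_boot all_order all_algebra.
From mathcomp Require Import all_classical all_reals all_analysis.

Set Implicit Arguments.
Unset Strict Implicit.
Unset Printing Implicit Defensive.

Import Order.TTheory GRing.Theory Num.Theory.
Import numFieldNormedType.Exports.

Local Open Scope classical_set_scope.
Local Open Scope ring_scope.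

(** * Smooth maps between normed spaces *)

(** Class C^n through iterated tangent maps: [f] is C^(n+1) on the open set [U]
    when it is Frechet differentiable there and (x, v) |-> Df(x)v is C^n on
    [U * E].  For a fixed n in infinite dimension this asks slightly less than
    norm continuity of D^n f, but C^(n+1) in this sense implies C^n in the norm
    sense, so that [smooth_on] is the usual class C^oo. *)
Fixpoint Ck (R : realType) (n : nat) (E F : normedModType R) (U : set E)
    (f : E -> F) : Prop :=
  match n with
  | 0 => forall x, U x -> {for x, continuous f}
  | m.+1 => (forall x, U x -> differentiable f x) /\
            @Ck R m (E * E)%type F (U `*` setT) (fun p => 'd f (p.1) p.2)
  end.

Definition smooth_on (R : realType) (E F : normedModType R) (U : set E)
  (f : E -> F) : Prop := forall n, Ck n U f.

(** * Charts *)

Lemma open_prod (M N : topologicalType) (A : set M) (B : set N) :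
  open A -> open B -> open (A `*` B).
Proof.
move=> oA oB; rewrite openE => -[x y] [/= Ax By].
by exists (A, B) => //=; split; exact: open_nbhs_nbhs.
Qed.

(** [chart_map] and [chart_inv] are total functions, meaningful only on
    [chart_dom] and on its image. *)
Record chart (R : realType) (E : normedModType R) (M : topologicalType) := Chart {
  chart_dom : set M;
  chart_map :> M -> E;
  chart_inv : E -> M;
  chart_dom_open : open chart_dom;
  chart_image_open : open (chart_map @` chart_dom);
  chart_mapK : forall x, chart_dom x -> chart_inv (chart_map x) = x;
  chart_continuous : forall x, chart_dom x -> {for x, continuous chart_map};
  chart_inv_continuous :
    forall u, (chart_map @` chart_dom) u -> {for u, continuous chart_inv}
}.

Section Charts.
Context (R : realType).

Program Definition id_chart (E : normedModType R) : chart E E :=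
  @Chart R E E setT id id openT _ _ _ _.
Next Obligation. by move=> E; rewrite image_id; exact: openT. Qed.
Next Obligation. by []. Qed.
Next Obligation. by move=> E x _; exact: cvg_id. Qed.
Next Obligation. by move=> E x _; exact: cvg_id. Qed.

Program Definition prod_chart (E F : normedModType R) (M N : topologicalType)
    (phi : chart E M) (psi : chart F N) : chart (E * F)%type (M * N)%type :=
  @Chart R (E * F)%type (M * N)%type (chart_dom phi `*` chart_dom psi)
    (fun p => (phi p.1, psi p.2))
    (fun u => (chart_inv phi u.1, chart_inv psi u.2)) _ _ _ _ _.
Next Obligation.
move=> E F M N phi psi; apply: open_prod; exact: chart_dom_open.
Qed.
Next Obligation.
move=> E F M N phi psi.
rewrite (_ : image _ _ =
  (phi @` chart_dom phi) `*` (psi @` chart_dom psi)).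
  by apply: open_prod; exact: chart_image_open.
apply/seteqP; split=> [_ [[x y] /= [dx dy] <-]|[u v] /= [[x dx <-] [y dy <-]]].
  by split; [exists x|exists y].
by exists (x, y).
Qed.
Next Obligation.
by move=> E F M N phi psi [x y] /= [dx dy]; rewrite !chart_mapK.
Qed.
Next Obligation.
move=> E F M N phi psi [x y] /= [dx dy].
apply: cvg_pair => /=.
  by apply: (cvg_comp _ _ cvg_fst); exact: chart_continuous.
by apply: (cvg_comp _ _ cvg_snd); exact: chart_continuous.
Qed.
Next Obligation.
move=> E F M N phi psi _ /= [[x y] /= [dx dy] <-].
apply: cvg_pair => /=.
  by apply: (cvg_comp _ _ cvg_fst); apply: chart_inv_continuous; exists x.
by apply: (cvg_comp _ _ cvg_snd); apply: chart_inv_continuous; exists y.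
Qed.

Context (E F : normedModType R) (M N : topologicalType).
Implicit Types (phi : chart E M) (psi : chart F N).

Definition chart_rep phi psi (f : M -> N) : E -> F := psi \o f \o chart_inv phi.

(** [f] is smooth on a neighbourhood of [x], for charts [phi] at [x] and [psi]
    at [f x]. *)
Definition smooth_near phi psi (f : M -> N) (x : M) : Prop :=
  exists V : set E, [/\ open V, V (phi x),
    V `<=` phi @` (chart_dom phi `&` f @^-1` chart_dom psi) &
    smooth_on V (chart_rep phi psi f)].

Definition chart_diff phi psi (f : M -> N) (x : M) : E -> F :=
  'd (chart_rep phi psi f) (phi x).

End Charts.

(** * Manifolds *)

HB.mixin Record isManifold (R : realType) (E : normedModType R) (M : Type)
    of Topological M := {
  chart_at : M -> chart E M;
  chart_at_dom : forall x, chart_dom (chart_at x) x;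
  chart_at_compat : forall x y, smooth_on
    (chart_at x @` (chart_dom (chart_at x) `&` chart_dom (chart_at y)))
    (chart_rep (chart_at x) (chart_at y) id);
  manifold_hausdorff : hausdorff_space M
}.

#[short(type="manifoldType")]
HB.structure Definition Manifold (R : realType) (E : normedModType R) :=
  {M of Topological M & @isManifold R E M}.

(** The tangent space at [x] is represented in the chart [chart_at x]: a tangent
    vector at [x] is its coordinate vector in that chart. *)
Definition tangent (R : realType) (E : normedModType R) (M : manifoldType E)
  (x : M) : normedModType R := E.

Section Manifolds.
Context (R : realType) (E : normedModType R) (M : manifoldType E).

Definition tangent_map (f : M -> M) (x : M) (v : tangent x) : tangent (f x) :=
  chart_diff (chart_at x) (chart_at (f x)) f x v.

Arguments tangent_map : clear implicits.

Definition differential (f : M -> R) (x : M) (v : tangent x) : R :=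
  chart_diff (chart_at x) (id_chart R^o) f x v.
Arguments differential : clear implicits.

Definition curve_smooth_near (c : R -> M) (t : R) : Prop :=
  smooth_near (id_chart R^o) (chart_at (c t)) c t.

Definition velocity (c : R -> M) (t : R) : tangent (c t) :=
  chart_diff (id_chart R^o) (chart_at (c t)) c t 1.

(** Vector field [X] read in the chart at [x]. *)
Definition field_rep (X : forall y : M, tangent y) (x : M) (u : E) : E :=
  let y := chart_inv (chart_at x) u in
  chart_diff (chart_at y) (chart_at x) id y (X y).

(** [X, Y]_JL = DY.X - DX.Y in coordinates. *)
Definition jacobi_lie (X Y : forall y : M, tangent y) (x : M) : tangent x :=
  'd (field_rep Y x) (chart_at x x) (X x) -
  'd (field_rep X x) (chart_at x x) (Y x).

End Manifolds.

Arguments tangent_map {R E M} f x v.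
Arguments differential {R E M} f x v.

(** * Lie groups *)

HB.mixin Record isLieGroup (R : realType) (E : normedModType R) (G : Type)
    of @Manifold R E G & Group G := {
  lie_mul_smooth : forall x y : G, smooth_near
    (prod_chart (chart_at x) (chart_at y)) (chart_at (x * y)%g)
    (fun p : G * G => (p.1 * p.2)%g) (x, y);
  lie_inv_smooth : forall x : G, smooth_near
    (chart_at x) (chart_at (x^-1)%g) (fun y : G => (y^-1)%g) x
}.

#[short(type="lieGroupType")]
HB.structure Definition LieGroup (R : realType) (E : normedModType R) :=
  {G of @Manifold R E G & Group G & @isLieGroup R E G}.

Section LieGroups.
Context (R : realType) (E : normedModType R) (G : lieGroupType E).

Definition lie_algebra : normedModType R := tangent (1%g : G).

Definition rmul (g : G) : G -> G := fun h => (h * g)%g.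

(** T_e R_g : T_e G -> T_g G *)
Definition rtranslate (g : G) (xi : lie_algebra) : tangent g :=
  tangent_map (rmul g) 1%g xi.

(** T_g R_(g^-1) : T_g G -> T_e G *)
Definition rtrivialize (g : G) (U : tangent g) : lie_algebra :=
  tangent_map (rmul (g^-1)%g) g U.

Definition lie_bracket (xi eta : lie_algebra) : lie_algebra :=
  jacobi_lie (fun g => rtranslate g xi) (fun g => rtranslate g eta) (1%g : G).

(** Covectors are functions on the tangent space; pairing is application. *)
Definition rtranslate_dual (g : G) (alpha : tangent g -> R) (xi : lie_algebra) :
  R := alpha (rtranslate g xi).

Definition ad_dual (xi : lie_algebra) (mu : lie_algebra -> R)
  (eta : lie_algebra) : R := mu (lie_bracket xi eta).

End LieGroups.

Arguments lie_algebra {R E} G.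
Arguments rtranslate {R E G} g xi.
Arguments rtrivialize {R E G} g U.
Arguments rtranslate_dual {R E G} g alpha xi.

(** * Duality *)

Section Duality.
Context (R : realType) (E : normedModType R).
Implicit Types mu nu : E -> R.

Definition in_dual mu : Prop :=
  linear (mu : E -> R^o) /\ continuous (mu : E -> R^o).

(** The operator norm of [mu] is at most [c]. *)
Definition dual_norm_le mu (c : R) : Prop := forall x, `|mu x| <= c * `|x|.

Definition in_bidual (Phi : (E -> R) -> R) : Prop :=
  (forall (k : R) mu nu, in_dual mu -> in_dual nu ->
     Phi (fun x => k * mu x + nu x) = k * Phi mu + Phi nu) /\
  exists C : R, forall mu c,
    in_dual mu -> dual_norm_le mu c -> `|Phi mu| <= C * c.

Definition reflexive_space : Prop :=
  forall Phi, in_bidual Phi ->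
    exists x : E, forall mu, in_dual mu -> Phi mu = mu x.

(** [nu] is the derivative at [t] of the curve [mu] for the dual norm. *)
Definition is_dual_derivative (mu : R -> E -> R) (t : R) (nu : E -> R) : Prop :=
  forall eps : R, 0 < eps -> \forall h \near (0 : R),
    dual_norm_le (fun x => mu (t + h) x - mu t x - h * nu x) (eps * `|h|).

End Duality.

(** * Lagrangian dynamics on the right-trivialized tangent bundle *)

Section Lagrangian.
Context (R : realType) (E : normedModType R) (G : lieGroupType E).
Implicit Types (L : G -> lie_algebra G -> R) (g : R -> G) (a b t : R).

Definition smooth_lagrangian L : Prop :=
  forall h xi, smooth_near
    (prod_chart (chart_at h) (id_chart (lie_algebra G))) (id_chart R^o)
    (fun p : G * lie_algebra G => L p.1 p.2) (h, xi).

Definition dL_dg L (h : G) (xi : lie_algebra G) : tangent h -> R :=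
  differential (fun k => L k xi) h.
Arguments dL_dg : clear implicits.

Definition dL_dxi L (h : G) (xi : lie_algebra G) : lie_algebra G -> R :=
  'd (L h : lie_algebra G -> R^o) xi.

Definition trivialized_velocity g t : lie_algebra G :=
  rtrivialize (g t) (velocity g t).

(** Smooth on a neighbourhood of [a, b]. *)
Definition smooth_curve a b g : Prop :=
  forall t, t \in `[a, b] -> curve_smooth_near g t.

Definition action L a b g : R :=
  (\int[lebesgue_measure]_(t in [set` `[a, b]])
     L (g t) (trivialized_velocity g t))%R.

(** A family [c s] of curves, smooth in (s, t) on a neighbourhood of
    {0} * [a, b], with [c 0 = g] on [a, b]; the variation of [g] is
    [variation_field c t]. *)
Definition variation_field (c : R -> R -> G) t : tangent (c 0 t) :=
  velocity (fun s => c s t) 0.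

Definition is_variation a b g (c : R -> R -> G) : Prop :=
  [/\ forall t, t \in `[a, b] -> smooth_near (id_chart (R^o * R^o)%type)
        (chart_at (c 0 t)) (fun p : R^o * R^o => c p.1 p.2) (0, t),
      forall t, t \in `[a, b] -> c 0 t = g t,
      variation_field c a = 0 & variation_field c b = 0].

Definition stationary L a b g : Prop :=
  forall c, is_variation a b g c ->
    is_derive (0 : R) (1 : R) (fun s => action L a b (c s) : R^o) 0.

(** d/dt dL/dxi = T_e^* R_g dL/dg + ad_xi^* dL/dxi, in the dual of the Lie
    algebra. *)
Definition trivialized_euler_lagrange L g t : Prop :=
  let xi := trivialized_velocity g in
  is_dual_derivative (fun s => dL_dxi L (g s) (xi s)) t
    (fun eta => rtranslate_dual (g t) (dL_dg L (g t) (xi t)) eta +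
                ad_dual (xi t) (dL_dxi L (g t) (xi t)) eta).

End Lagrangian.

Arguments dL_dg {R E G} L h xi.

(* Main.v *)
Require Import Defs.
From HB Require Import structures.
From mathcomp Require Import all_boot all_order all_algebra.
From mathcomp Require Import all_classical all_reals all_analysis.
From mathcomp Require Import ring lra.

Set Implicit Arguments.
Unset Strict Implicit.
Unset Printing Implicit Defensive.

Import Order.TTheory GRing.Theory Num.Theory.
Import numFieldNormedType.Exports.

Local Open Scope classical_set_scope.
Local Open Scope ring_scope.

(** Along a curve g with trivialized velocity xi, let p = dL/dxi be the momentum,
    and for a family of curves through g let eta = T R_(g^-1) (delta g).  The
    induced variation of xi is d eta/dt + [xi, eta], hence

      d/ds L(g, xi) = <T_e^* R_g dL/dg, eta> + <p, d eta/dt + [xi, eta]>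
                    = d/dt <p, eta> + <r, eta>,
      where r = T_e^* R_g dL/dg + ad_xi^* p - dp/dt

    ([first_variation], [lagrangian_variation]).  The total derivative integrates
    to 0 because eta vanishes at the end points, so the action is stationary as
    soon as the residual covector r vanishes.  Conversely, the curves whose value
    at t is the product of the point of coordinates e + s chi(t) w (in the chart
    at the unit, which has coordinates e there) with g(t) have eta = chi w.  As
    everything is smooth, chi = (t - a) (b - t) <r, w> is an admissible choice;
    stationarity then says that the integral of (t - a) (b - t) <r, w>^2 is 0, so
    that <r, w> = 0 for every w.

    The formula for the variation of xi is local and invariant under right
    translations, so a family may be translated to pass through the unit at the
    point (0, t0) under study and then be read in the chart u at the unit.  There
    xi = omega(du/dt) and eta = omega(du/ds) for the right Maurer-Cartan form
    omega, and the bracket is the antisymmetrized differential of omega at the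
    unit ([lie_bracketE]); the formula is the difference of the two derivatives
    ([structure_equation]).  It is needed only after applying the covector p, so
    that the equality of mixed derivatives is used for real functions alone
    ([diff_symmetric]).

    The time derivative of p is taken in the dual norm.  A smooth family of
    continuous linear forms is differentiable in that sense as soon as it is
    smooth jointly in time and argument ([is_dual_derivative_smooth]), so the
    Euler-Lagrange equation can be tested on one vector at a time
    ([euler_lagrangeP]). *)

(** * Smooth maps between normed spaces *)

Section NearDiff.
Context (R : realType) (E F : normedModType R).
Implicit Types (f g : E -> F) (x : E).

Lemma near_eq_is_diff f g x (df : E -> F) :
  (\forall y \near x, f y = g y) -> is_diff x f df -> is_diff x g df.
Proof.
move=> fg [dfx <-].
have [cdf fE] := (diff_locallyP _ _).1 dfx.
have gE : g \o shift x = cst (g x) + 'd f x +o_ 0 id.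
  apply/eqaddoP => e e0.
  have /eqaddoP/(_ _ e0) H := fE.
  have fg0 : \forall h \near (0 : E), f (h + x) = g (h + x).
    by have := fg; rewrite (near_shift 0) /= subr0.
  near=> h.
  have : `|((f \o shift x) - (cst (f x) + 'd f x)) h| <= e * `|h|.
    by near: h; exact: H.
  rewrite /= !fctE /= /cst /= (nbhs_singleton fg).
  suff -> : f (h + x) = g (h + x) by [].
  by near: h.
have gd : 'd g x = 'd f x :> (E -> F) by apply: diff_unique.
apply: DiffDef; last exact: gd.
by apply/diff_locallyP; rewrite gd.
Unshelve. all: by end_near. Qed.

Lemma near_eq_diff f g x : (\forall y \near x, f y = g y) ->
  differentiable f x -> 'd f x = 'd g x :> (E -> F).
Proof. by move=> fg df; have [_ ->] := near_eq_is_diff fg (differentiableP df). Qed.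

Lemma near_eq_differentiable f g x : (\forall y \near x, f y = g y) ->
  differentiable f x -> differentiable g x.
Proof. by move=> fg df; have [] := near_eq_is_diff fg (differentiableP df). Qed.

Lemma is_diff_linear f x : linear f -> continuous f -> is_diff x f f.
Proof.
move=> lf cf; pose fM := GRing.isLinear.Build _ _ _ _ f lf.
pose fL : {linear E -> F} := HB.pack f fM.
by apply: DiffDef; [apply: (@linear_differentiable _ _ _ fL)|apply: (@diff_lin _ _ _ fL)].
Qed.

End NearDiff.

Lemma continuous_proj1 (R : realType) (E F : normedModType R) :
  continuous (fst : E * F -> E).
Proof. by move=> x; exact: cvg_fst. Qed.

Lemma continuous_proj2 (R : realType) (E F : normedModType R) :
  continuous (snd : E * F -> F).
Proof. by move=> x; exact: cvg_snd. Qed.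

Section Ck.
Context (R : realType).

Lemma Ck_sub n : forall (E F : normedModType R) (U V : set E) (f : E -> F),
  V `<=` U -> Ck n U f -> Ck n V f.
Proof.
elim: n => [|n IH] E F U V f VU /=; first by move=> h x /VU/h.
move=> [df Df]; split; first by move=> x /VU/df.
by apply: IH Df => -[x v] [/= /VU].
Qed.

Lemma Ck_eq n : forall (E F : normedModType R) (U : set E) (f g : E -> F),
  open U -> (forall x, U x -> f x = g x) -> Ck n U f -> Ck n U g.
Proof.
elim: n => [|n IH] E F U f g oU fg /=.
  move=> h x Ux; have cf : f y @[y --> x] --> f x := h x Ux.
  suff : g y @[y --> x] --> g x by [].
  rewrite -(fg x Ux); apply: cvg_trans cf; apply: near_eq_cvg.
  by apply: filterS (open_nbhs_nbhs (conj oU Ux)) => y /fg ->.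
have fgn x : U x -> \forall y \near x, f y = g y.
  by move=> Ux; apply: filterS (open_nbhs_nbhs (conj oU Ux)) => y /fg.
move=> [df Df]; split.
  by move=> x Ux; apply: near_eq_differentiable (df x Ux); exact: fgn.
apply: IH Df; first exact: open_prod oU openT.
by move=> [x v] [/= Ux _]; rewrite (near_eq_diff (fgn x Ux)) //; exact: df.
Qed.

Lemma CkW n : forall (E F : normedModType R) (U : set E) (f : E -> F),
  Ck n.+1 U f -> Ck n U f.
Proof.
elim: n => [|n IH] E F U f [df Df].
  by move=> x /df; exact: differentiable_continuous.
by split=> //; exact: IH.
Qed.

Lemma Ck_linear n : forall (E F : normedModType R) (U : set E) (f : E -> F),
  open U -> linear f -> continuous f -> Ck n U f.
Proof.
elim: n => [|n IH] E F U f oU lf cf /=; first by move=> x _; exact: cf.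
split; first by move=> x _; have [] := is_diff_linear x lf cf.
apply: (@Ck_eq _ _ _ _ (f \o snd)); first exact: open_prod oU openT.
  by move=> [x v] _ /=; have [_ ->] := is_diff_linear x lf cf.
apply: IH; first exact: open_prod oU openT.
  by move=> k u v /=; rewrite lf.
by move=> x; apply: continuous_comp; [exact: continuous_proj2|exact: cf].
Qed.

Lemma Ck_pair n : forall (E F G : normedModType R) (U : set E) (f : E -> F) (g : E -> G),
  open U -> Ck n U f -> Ck n U g -> Ck n U (fun x => (f x, g x)).
Proof.
elim: n => [|n IH] E F G U f g oU /=.
  by move=> cf cg x Ux; apply: cvg_pair; [exact: cf|exact: cg].
move=> [df Df] [dg Dg]; split.
  by move=> x Ux; apply: differentiable_pair; [exact: df|exact: dg].
have oUT := open_prod oU (@openT E).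
apply: Ck_eq (IH _ _ _ _ _ _ oUT Df Dg) => //.
move=> [x v] [/= Ux _]; rewrite diff_pair //; [exact: df|exact: dg].
Qed.

(** D(g o f) is Dg composed with the tangent map (x, v) |-> (f x, Df(x) v), so
    the induction only needs this tangent map to be one order less smooth than f. *)
Lemma Ck_comp n : forall (E F G : normedModType R) (U : set E) (V : set F)
    (f : E -> F) (g : F -> G),
  open U -> (forall x, U x -> V (f x)) ->
  Ck n U f -> Ck n V g -> Ck n U (g \o f).
Proof.
elim: n => [|n IH] E F G U V f g oU UV.
  by move=> /= cf cg x Ux; apply: continuous_comp; [exact: cf|exact/cg/UV].
move=> Cf Cg; have [df Df] := Cf; have [dg Dg] := Cg; split.
  by move=> x Ux; apply: differentiable_comp; [exact: df|exact/dg/UV].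
have oUT := open_prod oU (@openT E).
rewrite -/Ck.
refine (@Ck_eq n (E * E)%type G (U `*` setT)
  ((fun p : F * F => 'd g (p.1) p.2) \o (fun p : E * E => ((f \o fst) p, 'd f (p.1) p.2))) _ oUT _ _).
  by move=> [x v] [/= Ux _]; rewrite (diff_comp (df _ Ux) (dg _ (UV _ Ux))).
apply: (IH) Dg => //; first by move=> [x v] [/= Ux _]; split => //; exact: UV.
apply: Ck_pair => //; apply: (IH _ _ _ _ U) => //; last exact: CkW.
  by move=> x [].
by apply: Ck_linear => //; exact: continuous_proj1.
Qed.

(** Scaling is bilinear: its differential is a sum of two scalings precomposed
    with linear projections, so each order of smoothness gives the next. *)
Lemma Ck_scale n (E : normedModType R) :
  Ck n [set: R^o * E] (fun p : R^o * E => p.1 *: p.2).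
Proof.
elim: n => [|n IH] /=.
  by move=> x _; exact: scale_continuous.
pose b (k : R^o) (v : E) : E := k *: v.
have bl : bilinear_for *:%R *:%R b.
  split=> [u' a x y|u a x y]; rewrite /b /=.
    by rewrite scalerDl scalerA.
  by rewrite scalerDr !scalerA mulrC.
pose bM := bilinear_isBilinear.Build R R^o E E _ _ b bl.
pose bL : {bilinear R^o -> E -> E} := HB.pack b bM.
have cb : continuous (fun p => bL p.1 p.2) by move=> x; exact: scale_continuous.
have dsc (p : R^o * E) : is_diff p (fun p : R^o * E => p.1 *: p.2)
    (fun v : R^o * E => p.1 *: v.2 + v.1 *: p.2).
  apply: DiffDef; first exact: (differentiable_bilin p cb).
  by rewrite (diff_bilin p cb).
split; first by move=> x _; have [] := dsc x.
apply: (@Ck_eq _ _ _ _ ((fun p : E * E => p.1 + p.2) \o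
  (fun p : (R^o * E) * (R^o * E) =>
    (((fun p : R^o * E => p.1 *: p.2) \o (fun p : (R^o * E) * (R^o * E) => (p.1.1, p.2.2))) p,
     ((fun p : R^o * E => p.1 *: p.2) \o (fun p : (R^o * E) * (R^o * E) => (p.2.1, p.1.2))) p)))).
- exact: open_prod openT openT.
- by move=> [p v] _ /=; have [_ ->] := dsc p.
have oT : open ([set: R^o * E] `*` [set: R^o * E]) by exact: open_prod openT openT.
apply: (@Ck_comp _ _ _ _ _ setT) => //; last first.
  apply: Ck_linear; first exact: openT.
    by move=> k [u1 u2] [v1 v2] /=; rewrite scalerDr addrACA.
  by move=> x; exact: add_continuous.
have Cproj (i j : (R^o * E) * (R^o * E) -> R^o * E) :
    linear i -> linear j -> continuous i -> continuous j ->
    Ck n ([set: R^o * E] `*` [set: R^o * E]) (fun p => ((i p).1, (j p).2)).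
  move=> li lj ci cj; apply: Ck_pair => //.
    apply: (@Ck_linear _ _ _ _ (fst \o i)) => //.
      by move=> k u v /=; rewrite li.
    by move=> x; exact: (continuous_comp (ci x) (@continuous_proj1 _ _ _ (i x))).
  apply: (@Ck_linear _ _ _ _ (snd \o j)) => //.
    by move=> k u v /=; rewrite lj.
  by move=> x; exact: (continuous_comp (cj x) (@continuous_proj2 _ _ _ (j x))).
apply: Ck_pair => //; apply: (@Ck_comp _ _ _ _ _ setT) => //; apply: Cproj => //.
- exact: continuous_proj1.
- exact: continuous_proj2.
- exact: continuous_proj2.
- exact: continuous_proj1.
Qed.

End Ck.

(** The neighbourhood is not recorded, so that germs of maps compose without any
    bookkeeping of domains. *)
Definition smooth_at (R : realType) (E F : normedModType R) (f : E -> F) (x : E) : Prop :=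
  exists U : set E, [/\ open U, U x & smooth_on U f].

Section SmoothAt.
Context (R : realType).
Implicit Types (E F G : normedModType R).

Lemma smooth_at_near E F (f : E -> F) x :
  smooth_at f x -> \forall y \near x, smooth_at f y.
Proof.
move=> [U [oU Ux sf]]; apply: filterS (open_nbhs_nbhs (conj oU Ux)) => y Uy.
by exists U.
Qed.

Lemma smooth_at_differentiable E F (f : E -> F) x :
  smooth_at f x -> differentiable f x.
Proof. by move=> [U [oU Ux /(_ 1%N)[+ _]]]; apply. Qed.

Lemma smooth_at_continuous E F (f : E -> F) x :
  smooth_at f x -> {for x, continuous f}.
Proof. by move/smooth_at_differentiable/differentiable_continuous. Qed.

Lemma smooth_at_eq E F (f g : E -> F) x :
  (\forall y \near x, f y = g y) -> smooth_at f x -> smooth_at g x.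
Proof.
move=> fg [U [oU Ux sf]].
exists (U `&` (fun y => f y = g y)^°); split.
- by apply: openI => //; exact: open_interior.
- by split.
have oI : open (U `&` (fun y => f y = g y)^°).
  by apply: openI => //; exact: open_interior.
move=> n; apply: (@Ck_eq _ _ _ _ _ f) => //.
  by move=> y [_] /interior_subset.
by apply: Ck_sub (sf n) => y [].
Qed.

Lemma smooth_at_comp E F G (f : E -> F) (g : F -> G) x :
  smooth_at f x -> smooth_at g (f x) -> smooth_at (g \o f) x.
Proof.
move=> sfx [V [oV Vf sg]]; have cf := smooth_at_continuous sfx.
have [U [oU Ux sf]] := sfx.
have nV : nbhs x (f @^-1` V) by apply: cf; exact: open_nbhs_nbhs.
have oI : open (U `&` (f @^-1` V)^°) by apply: openI => //; exact: open_interior.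
exists (U `&` (f @^-1` V)^°); split=> //.
move=> n; apply: (@Ck_comp _ _ _ _ _ _ V) => //.
- by move=> y [_] /interior_subset.
- by apply: Ck_sub (sf n) => y [].
Qed.

Lemma smooth_at_pair E F G (f : E -> F) (g : E -> G) x :
  smooth_at f x -> smooth_at g x -> smooth_at (fun y => (f y, g y)) x.
Proof.
move=> [U [oU Ux sf]] [V [oV Vx sg]].
have oI := openI oU oV.
exists (U `&` V); split=> // n; apply: Ck_pair => //.
  by apply: Ck_sub (sf n) => y [].
by apply: Ck_sub (sg n) => y [].
Qed.

Lemma smooth_at_linear E F (f : E -> F) x :
  linear f -> continuous f -> smooth_at f x.
Proof.
by move=> lf cf; exists setT; split=> // [|n]; [exact: openT|apply: Ck_linear => //; exact: openT].
Qed.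

Lemma smooth_at_id E (x : E) : smooth_at id x.
Proof. by apply: smooth_at_linear => // y; exact: cvg_id. Qed.

Lemma smooth_at_fst E F G (f : E -> F * G) x :
  smooth_at f x -> smooth_at (fun y => (f y).1) x.
Proof.
move=> sf; apply: (smooth_at_comp (g := fst) sf).
by apply: smooth_at_linear => //; exact: continuous_proj1.
Qed.

Lemma smooth_at_snd E F G (f : E -> F * G) x :
  smooth_at f x -> smooth_at (fun y => (f y).2) x.
Proof.
move=> sf; apply: (smooth_at_comp (g := snd) sf).
by apply: smooth_at_linear => //; exact: continuous_proj2.
Qed.

Lemma smooth_at_cst E F (c : F) (x : E) : smooth_at (fun=> c) x.
Proof.
exists setT; split; [exact: openT|by []|case=> [|n] /=].
  by move=> y _; exact: cvg_cst.
split; first by move=> y _; exact: differentiable_cst.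
apply: (@Ck_eq _ _ _ _ _ (fun=> 0)).
- exact: open_prod openT openT.
- by move=> [y v] _ /=; rewrite (@diff_cst _ E F).
apply: Ck_linear; first exact: open_prod openT openT.
- by move=> k u v; rewrite scaler0 addr0.
- by move=> y; exact: cvg_cst.
Qed.

Lemma smooth_at_add E F (f g : E -> F) x :
  smooth_at f x -> smooth_at g x -> smooth_at (fun y => f y + g y) x.
Proof.
move=> sf sg; apply: (smooth_at_comp (g := fun p : F * F => p.1 + p.2) (smooth_at_pair sf sg)).
apply: smooth_at_linear.
  by move=> k [u1 u2] [v1 v2] /=; rewrite scalerDr addrACA.
by move=> y; exact: add_continuous.
Qed.

Lemma smooth_at_scale E F (k : E -> R^o) (f : E -> F) x :
  smooth_at k x -> smooth_at f x -> smooth_at (fun y => k y *: f y) x.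
Proof.
move=> sf sg; apply: (smooth_at_comp (g := fun p : R^o * F => p.1 *: p.2) (smooth_at_pair sf sg)).
by exists setT; split=> // [|n]; [exact: openT|exact: Ck_scale].
Qed.

Lemma smooth_at_sub E F (f g : E -> F) x :
  smooth_at f x -> smooth_at g x -> smooth_at (fun y => f y - g y) x.
Proof.
move=> sf sg; apply: (smooth_at_eq (f := fun y => f y + (-1 : R^o) *: g y)).
  by apply: nearW => y; rewrite scaleN1r.
by apply: smooth_at_add => //; apply: smooth_at_scale => //; exact: smooth_at_cst.
Qed.

Lemma smooth_at_diff E F G (f : E -> F) (a b : G -> E) x :
  smooth_at f (a x) -> smooth_at a x -> smooth_at b x ->
  smooth_at (fun y => 'd f (a y) (b y)) x.
Proof.
move=> [U [oU Ux sf]] sa sb.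
apply: (smooth_at_comp (g := fun p : E * E => 'd f (p.1) p.2) (smooth_at_pair sa sb)).
exists (U `*` setT); split=> //; first exact: open_prod oU openT.
by move=> n; have [] := sf n.+1.
Qed.

Lemma smooth_at_proj1 E F (x : E * F) : smooth_at fst x.
Proof. by apply: smooth_at_fst; exact: smooth_at_id. Qed.

Lemma smooth_at_proj2 E F (x : E * F) : smooth_at snd x.
Proof. by apply: smooth_at_snd; exact: smooth_at_id. Qed.

Lemma smooth_at_line1 (x y : R^o) : smooth_at (fun w : R^o => (w, y)) x.
Proof. by apply: smooth_at_pair; [exact: smooth_at_id|exact: smooth_at_cst]. Qed.

Lemma smooth_at_line2 (x y : R^o) : smooth_at (fun w : R^o => (x, w)) y.
Proof. by apply: smooth_at_pair; [exact: smooth_at_cst|exact: smooth_at_id]. Qed.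

End SmoothAt.

Section PartialDerivatives.
Context (R : realType).

Lemma near_pull (T U : topologicalType) (f : T -> U) (x : T) (Q : U -> Prop) :
  {for x, continuous f} -> (\forall y \near f x, Q y) -> \forall z \near x, Q (f z).
Proof. by move=> cf nQ; apply: cf. Qed.

Lemma diff_comp_pair (D E F K : normedModType R) (f : E * F -> K) (a : D -> E)
    (b : D -> F) z v :
  differentiable f (a z, b z) -> differentiable a z -> differentiable b z ->
  'd (fun y => f (a y, b y)) z v = 'd f (a z, b z) ('d a z v, 'd b z v).
Proof.
move=> df da db.
have dp := differentiable_pair da db.
by rewrite (diff_comp (g := f) dp df) /= (diff_pair da db).
Qed.

Lemma diff_id (E : normedModType R) (x v : E) : 'd id x v = v.
Proof. by rewrite diff_val. Qed.

Lemma diff_partial1 (E F K : normedModType R) (f : E * F -> K) p a x :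
  differentiable f (p, a) -> 'd (fun z => f (z, a)) p x = 'd f (p, a) (x, 0).
Proof.
move=> df; rewrite (diff_comp_pair (a := id) (b := fun=> a)) ?diff_id //.
by rewrite (@diff_cst _ E F).
Qed.

Lemma diff_partial2 (E F K : normedModType R) (f : E * F -> K) p a y :
  differentiable f (p, a) -> 'd (fun z => f (p, z)) a y = 'd f (p, a) (0, y).
Proof.
move=> df; rewrite (diff_comp_pair (a := fun=> p) (b := id)) ?diff_id //.
by rewrite (@diff_cst _ F E).
Qed.

Lemma diff_linear2 (E F K : normedModType R) (f : E * F -> K) p a y :
  differentiable f (p, a) -> linear (fun z => f (p, z)) ->
  continuous (fun z => f (p, z)) -> 'd f (p, a) (0, y) = f (p, y).
Proof.
move=> df lf cf; rewrite -diff_partial2 //.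
by have [_ ->] := is_diff_linear a lf cf.
Qed.

Lemma diff_partial1_homog (E F K : normedModType R) (f : E * F -> K) p x (k : R) v :
  differentiable f (p, x) -> differentiable f (p, k *: x) ->
  (forall z, f (z, k *: x) = k *: f (z, x)) ->
  'd f (p, k *: x) (v, 0) = k *: 'd f (p, x) (v, 0).
Proof.
move=> dx dkx fk.
have dg : differentiable (fun z => f (z, x)) p.
  have dp : differentiable (fun z : E => (z, x)) p.
    exact: (differentiable_pair (f := id) (g := fun=> x)).
  exact: (differentiable_comp (g := f) dp dx).
apply: etrans (esym (@diff_partial1 _ _ _ f p (k *: x) v dkx)) _.
apply: etrans _ (congr1 (fun y => k *: y) (@diff_partial1 _ _ _ f p x v dx)).
have -> : (fun z => f (z, k *: x)) = k \*: (fun z => f (z, x)).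
  by apply/funext => z; rewrite fk.
by rewrite diffZ.
Qed.

Lemma is_derive_diff (V : normedModType R) (f : R^o -> V) (x : R^o) :
  differentiable f x -> is_derive (x : R) (1 : R) (f : R -> V) ('d f x 1).
Proof. by move=> df; apply: DeriveDef; [exact: diff_derivable|rewrite deriveE]. Qed.

Lemma is_derive_partial1 (E : normedModType R) (g : R^o * E -> R^o) x y :
  smooth_at g (x, y) ->
  is_derive (x : R) (1 : R) (fun w : R => g (w, y)) ('d g (x, y) (1, 0)).
Proof.
move=> /smooth_at_differentiable dg; rewrite -(@diff_partial1 _ _ _ g x y 1 dg).
have dp : differentiable (fun w : R^o => (w, y)) x.
  exact: (differentiable_pair (f := id) (g := fun=> y)).
exact: is_derive_diff (differentiable_comp (g := g) dp dg).
Qed.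

Lemma is_derive_partial2 (E : normedModType R) (g : E * R^o -> R^o) x y :
  smooth_at g (x, y) ->
  is_derive (y : R) (1 : R) (fun w : R => g (x, w)) ('d g (x, y) (0, 1)).
Proof.
move=> /smooth_at_differentiable dg; rewrite -(@diff_partial2 _ _ _ g x y 1 dg).
have dp : differentiable (fun w : R^o => (x, w)) y.
  exact: (differentiable_pair (f := fun=> x) (g := id)).
exact: is_derive_diff (differentiable_comp (g := g) dp dg).
Qed.

End PartialDerivatives.

(** * Mixed second derivatives *)

Section Schwarz.
Context (R : realType).

(** The second difference of F over a square of side h, by the mean value theorem
    in each variable.  Exchanging the roles of the variables leaves the second
    difference unchanged and gives the other mixed derivative. *)
Lemma mixed_mvt (F F1 F12 : R -> R -> R) (s t h : R) : 0 < h ->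
  (forall x y, x \in `[s, s + h] -> y \in `[t, t + h] ->
     is_derive x (1 : R) (fun z : R => F z y : R^o) (F1 x y)) ->
  (forall x y, x \in `[s, s + h] -> y \in `[t, t + h] ->
     is_derive y (1 : R) (fun z : R => F1 x z : R^o) (F12 x y)) ->
  exists x y, [/\ x \in `[s, s + h], y \in `[t, t + h] &
    F (s + h) (t + h) - F (s + h) t - F s (t + h) + F s t = F12 x y * h * h].
Proof.
move=> h0 dF dF1.
have tI : t \in `[t, t + h] by rewrite in_itv /= lexx lerDl ltW.
have thI : t + h \in `[t, t + h] by rewrite in_itv /= lexx lerDl ltW.
pose k x := F x (t + h) - F x t.
have dk x : x \in `[s, s + h] -> is_derive x (1 : R) (k : R -> R^o) (F1 x (t + h) - F1 x t).
  by move=> xI; apply: is_deriveB; exact: dF.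
have ssh : s < s + h by rewrite ltrDl.
have tth : t < t + h by rewrite ltrDl.
have kd x : x \in `]s, s + h[ -> is_derive x (1 : R) (k : R -> R^o) (F1 x (t + h) - F1 x t).
  by move=> xI; apply: dk; exact: subset_itv_oo_cc xI.
have kc : {within `[s, s + h], continuous k}.
  by apply: derivable_within_continuous => x /dk [].
have [x xI kE] := @MVT R k _ _ _ ssh kd kc.
have xI' : x \in `[s, s + h] by exact: subset_itv_oo_cc xI.
have Fd y : y \in `]t, t + h[ -> is_derive y (1 : R) (F1 x : R -> R^o) (F12 x y).
  by move=> yI; apply: dF1 => //; exact: subset_itv_oo_cc yI.
have Fc : {within `[t, t + h], continuous (F1 x)}.
  by apply: derivable_within_continuous => y /(dF1 _ _ xI') [].
have [y yI FE] := @MVT R (F1 x) _ _ _ tth Fd Fc.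
exists x, y; split=> //; first exact: subset_itv_oo_cc yI.
have := kE; rewrite FE /k !(addrC _ h) !addrK => <-.
by rewrite opprB addrA addrAC.
Qed.

Lemma near_box (P : R^o * R^o -> Prop) (s t : R) : (\forall q \near ((s, t) : R^o * R^o), P q) ->
  exists2 r : R, 0 < r & forall x y, x \in `[s, s + r] -> y \in `[t, t + r] -> P (x, y).
Proof.
move=> /nbhs_ballP [r /= r0 rP]; exists (r / 2); first by rewrite divr_gt0.
have half (a x : R) : x \in `[a, a + r / 2] -> `|a - x| < r.
  rewrite in_itv /= => /andP [ax xa]; rewrite distrC ger0_norm ?subr_ge0 //.
  rewrite ltrBlDl (le_lt_trans xa) // ltrD2l ltr_pdivrMr // ltr_pMr //.
  by rewrite ltr1n.
move=> x y xI yI; apply: rP; split => /=; rewrite -ball_normE /=; exact: half.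
Qed.

(** Both mixed derivatives are continuous, and each takes, somewhere in any small
    square, the value of the second difference divided by the area. *)
Lemma diff_symmetric (f : R^o * R^o -> R^o) (z : R^o * R^o) : smooth_at f z ->
  'd (fun q => 'd f q (0, 1)) z (1, 0) = 'd (fun q => 'd f q (1, 0)) z (0, 1).
Proof.
case: z => s t sf.
pose fs (q : R^o * R^o) := 'd f q (1, 0); pose ft (q : R^o * R^o) := 'd f q (0, 1).
have sfs q : smooth_at f q -> smooth_at fs q.
  by move=> sq; apply: smooth_at_diff => //; [exact: smooth_at_id|exact: smooth_at_cst].
have sft q : smooth_at f q -> smooth_at ft q.
  by move=> sq; apply: smooth_at_diff => //; [exact: smooth_at_id|exact: smooth_at_cst].
pose fst_ (q : R^o * R^o) := 'd fs q (0, 1); pose fts (q : R^o * R^o) := 'd ft q (1, 0).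
rewrite -[LHS]/(fts (s, t)) -[RHS]/(fst_ (s, t)).
have cst_ : {for (s, t), continuous fst_}.
  apply: smooth_at_continuous; apply: smooth_at_diff; first exact: sfs.
    exact: smooth_at_id.
  exact: smooth_at_cst.
have cts : {for (s, t), continuous fts}.
  apply: smooth_at_continuous; apply: smooth_at_diff; first exact: sft.
    exact: smooth_at_id.
  exact: smooth_at_cst.
apply/eqP; rewrite -subr_eq0 -normr_le0; apply/ler_addgt0Pl => e e0; rewrite addr0.
have e20 : 0 < e / 2 by rewrite divr_gt0.
have n1 := cst_ _ (nbhsx_ballx _ _ e20).
have n2 := cts _ (nbhsx_ballx _ _ e20).
have nb : \forall q \near ((s, t) : R^o * R^o), [/\ smooth_at f q,
    `|fst_ (s, t) - fst_ q| < e / 2 & `|fts (s, t) - fts q| < e / 2].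
  by apply: filterS3 (smooth_at_near sf) n1 n2 => q sq; rewrite /= -!ball_normE.
have [h h0 box] := near_box nb.
have [x [y [xI yI E1]]] : exists x y, [/\ x \in `[s, s + h], y \in `[t, t + h] &
    f (s + h, t + h) - f (s + h, t) - f (s, t + h) + f (s, t) = fst_ (x, y) * h * h].
  apply: (@mixed_mvt (fun a b => f (a, b)) (fun a b => fs (a, b)) (fun a b => fst_ (a, b))) => //.
    by move=> x y xI yI; apply: is_derive_partial1; have [] := box _ _ xI yI.
  by move=> x y xI yI; apply: is_derive_partial2; apply: sfs; have [] := box _ _ xI yI.
have [y' [x' [yI' xI' E2]]] : exists y x, [/\ y \in `[t, t + h], x \in `[s, s + h] &
    f (s + h, t + h) - f (s, t + h) - f (s + h, t) + f (s, t) = fts (x, y) * h * h].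
  apply: (@mixed_mvt (fun b a => f (a, b)) (fun b a => ft (a, b)) (fun b a => fts (a, b))) => //.
    by move=> y' x' yI' xI'; apply: is_derive_partial2; have [] := box _ _ xI' yI'.
  by move=> y' x' yI' xI'; apply: is_derive_partial1; apply: sft; have [] := box _ _ xI' yI'.
have E3 : fst_ (x, y) = fts (x', y').
  apply: (mulIf (lt0r_neq0 h0)); apply: (mulIf (lt0r_neq0 h0)).
  by rewrite -E1 -E2; congr (_ + _); rewrite addrAC.
have [_ b1 _] := box _ _ xI yI; have [_ _ b2] := box _ _ xI' yI'.
have tri (A B C : R) : `|A - C| < e / 2 -> `|B - C| < e / 2 -> `|B - A| <= e.
  move=> AC BC; apply: le_trans (ler_distD C _ _) _.
  by rewrite (splitr e) lerD // ?(distrC C) ltW.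
by apply: tri b1 _; rewrite E3.
Qed.

End Schwarz.

(** * Curves of continuous linear forms *)

Section DualDerivative.
Context (R : realType).

Lemma mvt_ball (g g1 : R -> R) (t r h : R) :
  (forall y, `|y - t| < r -> is_derive y (1 : R) (g : R -> R^o) (g1 y)) -> `|h| < r ->
  exists2 c, `|c - t| <= `|h| & g (t + h) - g t = g1 c * h.
Proof.
move=> dg hr.
have [h0|h0|->] := ltgtP h 0; last first.
- by exists t; rewrite ?subrr ?normr0 // addr0 subrr mulr0.
- have th : t < t + h by rewrite ltrDl.
  have yB y : y \in `[t, t + h] -> `|y - t| <= `|h|.
    rewrite in_itv /= => /andP [ty yth].
    by rewrite !ger0_norm ?subr_ge0 // ?lerBlDl // ltW.
  have d1 y : y \in `]t, t + h[ -> is_derive y (1 : R) (g : R -> R^o) (g1 y).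
    by move=> /subset_itv_oo_cc /yB yh; apply: dg; exact: le_lt_trans yh hr.
  have c1 : {within `[t, t + h], continuous g}.
    apply: derivable_within_continuous => y /yB yh.
    by have [] := dg y (le_lt_trans yh hr).
  have [c cI cE] := @MVT R g g1 _ _ th d1 c1.
  exists c; first exact/yB/subset_itv_oo_cc.
  by rewrite cE addrAC subrr add0r.
- have th : t + h < t by rewrite gtrDl.
  have yB y : y \in `[t + h, t] -> `|y - t| <= `|h|.
    rewrite in_itv /= => /andP [ty yth].
    by rewrite distrC (ltr0_norm h0) ger0_norm ?subr_ge0 //; lra.
  have d1 y : y \in `]t + h, t[ -> is_derive y (1 : R) (g : R -> R^o) (g1 y).
    by move=> /subset_itv_oo_cc /yB yh; apply: dg; exact: le_lt_trans yh hr.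
  have c1 : {within `[t + h, t], continuous g}.
    apply: derivable_within_continuous => y /yB yh.
    by have [] := dg y (le_lt_trans yh hr).
  have [c cI cE] := @MVT R g g1 _ _ th d1 c1.
  exists c; first exact/yB/subset_itv_oo_cc.
  by rewrite -[LHS]opprB cE opprD addrA subrr add0r mulrN opprK.
Qed.

Lemma taylor_ball (g g1 g2 : R -> R) (t r C h : R) :
  (forall y, `|y - t| < r -> is_derive y (1 : R) (g : R -> R^o) (g1 y)) ->
  (forall y, `|y - t| < r -> is_derive y (1 : R) (g1 : R -> R^o) (g2 y)) ->
  (forall y, `|y - t| < r -> `|g2 y| <= C) -> `|h| < r ->
  `|g (t + h) - g t - h * g1 t| <= C * `|h| * `|h|.
Proof.
move=> dg dg1 C2 hr.
have [c ch ->] := mvt_ball dg hr.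
have [c' ch' g1E] := mvt_ball dg1 (le_lt_trans ch hr).
rewrite (mulrC h) -mulrBl normrM ler_wpM2r //.
rewrite -(subrK t c) (addrC _ t) g1E normrM ler_pM //.
exact/C2/(le_lt_trans ch')/(le_lt_trans ch).
Qed.

(** The second time derivative of mu is bounded near (t, 0), so the remainder of
    the first-order Taylor expansion in time is at most C h^2 for all vectors of a
    small ball.  It is homogeneous in the vector, hence at most D h^2 |x| for
    every x: the derivative, a priori taken vector by vector, is uniform on the
    unit ball. *)
Lemma is_dual_derivative_smooth (E : normedModType R) (mu : R -> E -> R) (t : R) :
  let M := (fun p : R^o * E => mu p.1 p.2 : R^o) in
  (forall x, smooth_at M (t, x)) -> (forall s, linear (mu s : E -> R^o)) ->
  is_dual_derivative mu t (fun x => 'd M (t, x) (1, 0)).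
Proof.
move=> M sM lM.
pose M1 p := 'd M p (1, 0); pose M2 p := 'd M1 p (1, 0).
have sM1 p : smooth_at M p -> smooth_at M1 p.
  by move=> sp; apply: smooth_at_diff => //; [exact: smooth_at_id|exact: smooth_at_cst].
have sM2 p : smooth_at M p -> smooth_at M2 p.
  move=> /sM1 sp; apply: smooth_at_diff => //; [exact: smooth_at_id|exact: smooth_at_cst].
have cM2 := smooth_at_continuous (sM2 _ (sM 0)).
(* By continuity C bounds M2 near (t, 0), with room 1. *)
pose C := `|M2 (t, 0)| + 1.
have C0 : 0 < C by rewrite ltr_wpDl.
have n1 := smooth_at_near (sM 0).
have n2 := cM2 _ (nbhsx_ballx _ _ ltr01).
have nb : \forall p \near ((t, 0) : R^o * E), smooth_at M p /\ `|M2 p| <= C.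
  apply: filterS2 n1 n2 => p sp; rewrite /= -ball_normE /= => bp; split=> //.
  rewrite -(subrK (M2 (t, 0)) (M2 p)) addrC (le_trans (ler_normD _ _)) // lerD2l.
  by rewrite distrC ltW.
have [r /= r0 rP] := (nbhs_ballP _ _).1 nb.
have box y (x : E) : `|y - t| < r -> `|x| < r -> smooth_at M (y, x) /\ `|M2 (y, x)| <= C.
  move=> yt xr; apply: rP; split; rewrite -ball_normE /=; first by rewrite distrC.
  by rewrite sub0r normrN.
have small h (x : E) : `|h| < r -> `|x| < r ->
    `|M (t + h, x) - M (t, x) - h * M1 (t, x)| <= C * `|h| * `|h|.
  move=> hr xr.
  apply: (@taylor_ball (fun y => M (y, x)) (fun y => M1 (y, x)) (fun y => M2 (y, x)) _ r) => //.
  - by move=> y yt; apply: is_derive_partial1; have [] := box _ _ yt xr.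
  - by move=> y yt; apply: is_derive_partial1; apply: sM1; have [] := box _ _ yt xr.
  - by move=> y yt; have [] := box _ _ yt xr.
have MZ k s (x : E) : M (s, k *: x) = k * M (s, x).
  pose fM := GRing.isLinear.Build _ _ _ _ _ (lM s).
  pose l : {linear E -> R^o} := HB.pack (mu s : E -> R^o) fM.
  exact: (linearZ_LR l k x).
have M1Z k (x : E) : M1 (t, k *: x) = k * M1 (t, x).
  apply: diff_partial1_homog; [exact: smooth_at_differentiable..|].
  by move=> s; exact: MZ.
have all_x h (x : E) : `|h| < r ->
    `|M (t + h, x) - M (t, x) - h * M1 (t, x)| <= (2 * C / r) * `|h| * `|h| * `|x|.
  move=> hr.
  (* x = k x' with |x'| = r / 2; for x = 0 both k and x' are 0. *)
  pose k := 2 * `|x| / r; pose x' := k^-1 *: x.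
  have k0 : 0 <= k by rewrite /k divr_ge0 ?mulr_ge0 // ltW.
  have [x'r xE] : `|x'| < r /\ x = k *: x'.
    have [x0|x0] := eqVneq x 0; first by rewrite /x' x0 !scaler0 normr0.
    have kn0 : k != 0.
      by rewrite /k !mulf_neq0 ?normr_eq0 ?invr_eq0 ?(lt0r_neq0 r0) ?pnatr_eq0.
    split; last by rewrite /x' scalerA divff ?scale1r.
    have -> : `|x'| = r / 2.
      rewrite normrZ normfV (ger0_norm k0) /k.
      by field; rewrite normr_eq0 x0 lt0r_neq0.
    by rewrite ltr_pdivrMr // ltr_pMr // ltr1n.
  have eqk : M (t + h, x) - M (t, x) - h * M1 (t, x) =
      k * (M (t + h, x') - M (t, x') - h * M1 (t, x')).
    by rewrite {1 2 3}xE !MZ M1Z !mulrBr; congr (_ - _); exact: mulrCA.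
  rewrite eqk normrM (ger0_norm k0).
  apply: le_trans (ler_wpM2l k0 (small _ _ hr x'r)) _.
  by rewrite le_eqVlt; apply/orP; left; apply/eqP; rewrite /k; ring.
move=> eps eps0.
pose D := 2 * C / r.
have D0 : 0 < D by rewrite /D divr_gt0 // mulr_gt0.
have near0_lt (d : R) : 0 < d -> \forall h \near (0 : R), `|h| < d.
  move=> d0; apply/nbhs_ballP; exists d => // h.
  by rewrite -ball_normE /= sub0r normrN.
have n3 := near0_lt _ r0.
have n4 := near0_lt _ (divr_gt0 eps0 D0).
apply: filterS2 n3 n4 => h hr he x.
apply: le_trans (all_x _ _ hr) _; rewrite -/D ler_wpM2r // ler_wpM2r //.
by rewrite mulrC -ler_pdivlMr // ltW.
Qed.

Lemma is_dual_derivative_unique (E : normedModType R) (mu : R -> E -> R) (t : R) nu nu' :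
  is_dual_derivative mu t nu -> is_dual_derivative mu t nu' -> nu =1 nu'.
Proof.
move=> d d' x; apply/eqP; rewrite -subr_eq0 -normr_le0; apply/ler_addgt0Pl => e e0.
rewrite addr0.
(* The two remainders add up to at most 2 eps |h| |x| < e |h|. *)
pose eps := e / (2 * (`|x| + 1)).
have x1 : 0 < `|x| + 1 by rewrite ltr_wpDl.
have eps0 : 0 < eps by rewrite /eps divr_gt0 // mulr_gt0.
have [r /= r0 rP] := (nbhs_ballP _ _).1 (filterI (d _ eps0) (d' _ eps0)).
pose h := r / 2.
have h0 : 0 < h by rewrite /h divr_gt0.
have [|H H'] := rP h.
  rewrite -ball_normE /= sub0r normrN gtr0_norm // /h ltr_pdivrMr // ltr_pMr //.
  by rewrite ltr1n.
have {H} := H x; have {H'} := H' x; rewrite (gtr0_norm h0).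
set A := mu (t + h) x - mu t x => B2 B1.
have : `|h * nu x - h * nu' x| <= eps * h * `|x| + eps * h * `|x|.
  have -> : h * nu x - h * nu' x = (A - h * nu' x) - (A - h * nu x).
    by rewrite opprB [RHS]addrC addrA subrK.
  by rewrite (le_trans (ler_normB _ _)) // lerD.
rewrite -mulrBr normrM (gtr0_norm h0) => /le_trans H.
rewrite -(ler_pM2l h0); apply: H.
have epsE : eps * (`|x| + 1) = e / 2 by rewrite /eps; field; rewrite lt0r_neq0.
have hE : h * (eps * (`|x| + 1)) = h * (e / 2) by rewrite epsE.
have hp : 0 < h * eps by rewrite mulr_gt0.
by lra.
Qed.

End DualDerivative.

(** * Integrals over a segment *)

Section Integrals.
Context (R : realType) (a b : R).
Local Notation mu := (@lebesgue_measure R).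

Lemma within_continuous_itv (f : R -> R) :
  (forall t, t \in `[a, b] -> {for t, continuous f}) ->
  {within `[a, b], continuous f}.
Proof.
move=> cf; apply: continuous_in_subspaceT => t; rewrite inE => tI; exact: cf.
Qed.

Lemma integrable_continuous_itv (f : R -> R) :
  (forall t, t \in `[a, b] -> {for t, continuous f}) ->
  mu.-integrable `[a, b] (EFin \o f).
Proof.
move=> cf; apply: continuous_compact_integrable; first exact: segment_compact.
exact: within_continuous_itv.
Qed.

Lemma Rintegral_diff (q : R^o -> R^o) : a < b ->
  (forall t, t \in `[a, b] -> smooth_at q t) ->
  (\int[mu]_(t in [set` `[a, b]]) ('d q t 1 : R))%R = q b - q a.
Proof.
move=> ab sq.
have dq t : t \in `[a, b] -> derivable (q : R -> R^o) t 1.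
  by move=> /sq/smooth_at_differentiable dq; exact: diff_derivable.
have cq t : t \in `[a, b] -> {for t, continuous q}.
  by move=> /sq/smooth_at_continuous.
rewrite /Rintegral (@continuous_FTC2 _ (fun t => 'd q t 1) q a b ab) //.
- apply: within_continuous_itv => t /sq st.
  apply: (@smooth_at_continuous _ _ _ (fun t : R^o => 'd q t 1)).
  by apply: smooth_at_diff => //; [exact: smooth_at_id|exact: smooth_at_cst].
- split.
  + by move=> t tI; apply: dq; exact: subset_itv_oo_cc tI.
  + by apply: cvg_at_right_filter; apply: cq; rewrite in_itv /= lexx ltW.
  + by apply: cvg_at_left_filter; apply: cq; rewrite in_itv /= lexx ltW.
- move=> t /subset_itv_oo_cc /sq/smooth_at_differentiable dqt.
  by rewrite derive1E deriveE.
Qed.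

(** The integrand vanishes almost everywhere, while by continuity a positive value
    would persist on an interval of positive measure. *)
Lemma Rintegral_eq0 (k : R -> R) :
  (forall t, t \in `[a, b] -> {for t, continuous k}) ->
  (forall t, t \in `[a, b] -> 0 <= k t) ->
  (\int[mu]_(t in [set` `[a, b]]) k t)%R = 0 ->
  forall t, t \in `]a, b[ -> k t = 0.
Proof.
move=> ck k0 Ik t tI; apply/eqP; apply: contraT => kt0.
have tI' : t \in `[a, b] by exact: subset_itv_oo_cc tI.
have kt : 0 < k t by rewrite lt_neqAle eq_sym kt0 k0.
have intk := integrable_continuous_itv ck.
have Ik0 : (\int[mu]_(x in `[a, b]) `|(k x)%:E| = 0)%E.
  rewrite -[RHS]/(0%:E) -Ik /Rintegral fineK; last exact: integrable_fin_num.
  by apply: eq_integral => x; rewrite inE => xI; rewrite gee0_abs // lee_fin k0.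
have /integrableP [mk _] := intk.
have [A [mA A0 kA]] := (ae_eq_integral_abs mu (measurable_itv _) mk).1 Ik0.
have n1 : \forall x \near t, 0 < k x.
  exact: cvgr_gt (ck _ tI') _ kt.
have n2 : \forall x \near t, x \in `]a, b[ by exact: near_in_itvoo.
have [r /= r0 rP] := (nbhs_ballP _ _).1 (filterI n1 n2).
pose B : set R := `]t - r, t + r[%classic.
have sub : B `<=` A.
  move=> x /= xI; apply: kA => /= H.
  have [kx xab] : 0 < k x /\ x \in `]a, b[.
    apply: rP; rewrite -ball_normE /= ltr_distlC.
    by move: xI; rewrite /B /= in_itv.
  have /H [kx0] : `[a, b]%classic x by exact: subset_itv_oo_cc xab.
  by move: kx; rewrite kx0 ltxx.
have : (mu B <= mu A)%E.
  by apply: le_measure => //; rewrite inE //; exact: measurable_itv.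
rewrite A0 /B lebesgue_measure_itv /= lte_fin.
have lt_r : t - r < t + r by rewrite ltrBlDr -addrA ltrDl addr_gt0.
by rewrite lt_r -EFinB lee_fin leNgt subr_gt0 lt_r.
Qed.

(** Compactness of the segment {0} x [a, b] gives a strip |s| < r on which F is
    smooth and its s-derivative stays within 1 of its values at s = 0; these
    values plus 1 form the dominating function. *)
Lemma is_derive_Rintegral (F : R^o * R^o -> R^o) :
  (forall t, t \in `[a, b] -> smooth_at F (0, t)) ->
  is_derive (0 : R) (1 : R)
    (fun s => (\int[mu]_(t in [set` `[a, b]]) (F (s, t) : R))%R : R^o)
    (\int[mu]_(t in [set` `[a, b]]) ('d F (0, t) (1, 0) : R))%R.
Proof.
move=> sF.
pose F1 (q : R^o * R^o) : R^o := 'd F q (1, 0).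
have sF1 q : smooth_at F q -> smooth_at F1 q.
  by move=> sq; apply: smooth_at_diff => //; [exact: smooth_at_id|exact: smooth_at_cst].
pose P (s t : R) := smooth_at F (s, t) /\ `|F1 (0, t) - F1 (s, t)| < 1.
have nP : \forall s \near (0 : R), `[a, b]%classic `<=` P s.
  have cov := (compact_near_coveringP `[a, b]%classic).1 (@segment_compact R a b).
  refine (cov R (nbhs (0 : R)) P (nbhs_filter (0 : R)) _).
  move=> t tI; pose z : R^o * R^o := (0, t); have st : smooth_at F z := sF t tI.
  have c1 := smooth_at_continuous (sF1 _ st).
  have n1 := smooth_at_near st.
  have n2 : \forall q \near z, `|F1 z - F1 q| < 2^-1.
    have h : 0 < 2^-1 :> R by rewrite invr_gt0.
    have nb : \forall y \near F1 z, `|F1 z - y| < 2^-1.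
      by apply/nbhs_ballP; exists (2^-1) => // y; rewrite -ball_normE.
    exact: (near_pull c1 nb).
  have n3 : \forall q \near z, `|F1 z - F1 (0, q.2)| < 2^-1.
    apply: (near_pull (f := fun q : R^o * R^o => (0 : R^o, q.2)) _ n2).
    apply/smooth_at_continuous/smooth_at_pair; first exact: smooth_at_cst.
    exact: smooth_at_proj2.
  have tri (A B C : R) : `|C - A| < 2^-1 -> `|C - B| < 2^-1 -> `|A - B| < 1.
    move=> CA CB; rewrite (le_lt_trans (ler_distD C _ _)) // (splitr 1) div1r.
    by rewrite (distrC A) ltrD.
  have n4 : \forall q \near z, P q.1 q.2.
    apply: filterS3 n1 n2 n3 => -[s t'] /= s1 b1 b2; split=> //=.
    exact: tri b2 b1.
  have [r /= r0 rP] := (nbhs_ballP _ _).1 n4.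
  exists (ball t r, ball (0 : R) r).
    by split; exact: nbhsx_ballx.
  by move=> [t' s] [/= bt bs]; exact: (rP (s, t') (conj bs bt)).
have [r /= r0 rP] := (nbhs_ballP _ _).1 nP.
have rP' s t : `]- r, r[%classic s -> t \in `[a, b] -> P s t.
  rewrite /= in_itv /= => sr tI; apply: rP => //.
  by rewrite -ball_normE /= sub0r normrN ltr_norml.
pose f (s t : R) : R := F (s, t).
have I0 : `]- r, r[%classic (0 : R) by rewrite /= in_itv /= oppr_lt0 r0.
have d1 s t : smooth_at F (s, t) -> is_derive (s : R) (1 : R) (f^~ t : R -> R^o) (F1 (s, t)).
  exact: is_derive_partial1.
have pE s t : smooth_at F (s, t) -> partial1of2 f s t = F1 (s, t).
  by move=> /d1 dst; rewrite partial1of2E derive_val.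
have cont2 (g : R^o * R^o -> R^o) s t : smooth_at g (s, t) ->
    {for t, continuous (fun w : R => g (s, w) : R)}.
  move=> sg; apply: (@smooth_at_continuous _ _ _ (fun w : R^o => g (s, w))).
  by apply: (smooth_at_comp (g := g) (smooth_at_line2 s t)).
have intf s : `]- r, r[%classic s -> mu.-integrable `[a, b] (EFin \o f s).
  move=> sr; apply: integrable_continuous_itv => t tI; apply: cont2.
  by have [] := rP' s t sr tI.
have derf s t : `]- r, r[%classic s -> `[a, b]%classic t -> derivable (f^~ t) s 1.
  by move=> sr tI; have [st _] := rP' s t sr tI; have [] := d1 _ _ st.
pose H t := `|F1 (0, t)| + 1.
have H0 t : 0 <= H t by rewrite addr_ge0.
have intH : mu.-integrable `[a, b] (EFin \o H).
  apply: integrable_continuous_itv => t tI.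
  apply: (@cvgD _ R^o); last exact: cvg_cst.
  by apply: (@cvg_norm _ R^o); apply: cont2; exact: sF1 (sF _ tI).
have ubH s t : `]- r, r[%classic s -> `[a, b]%classic t -> `|partial1of2 f s t| <= H t.
  move=> sr tI; have [st b1] := rP' s t sr tI; rewrite pE //.
  rewrite -(subrK (F1 (0, t)) (F1 (s, t))) /H addrC (le_trans (ler_normD _ _)) //.
  by rewrite lerD2l distrC ltW.
have D' := @derivable_under_integral _ _ _ mu f `[a, b]%classic
  (measurable_itv _) 0 (- r) r I0 intf derf H H0 intH ubH.
apply: DeriveDef; first exact: D'.
apply: etrans (esym (derive1E _ _)) _.
apply: etrans (@differentiation_under_integral _ _ _ mu f `[a, b]%classic
  (measurable_itv _) 0 (- r) r I0 intf derf H H0 intH ubH) _.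
by apply: eq_Rintegral => t; rewrite inE => tI; rewrite pE //; exact: sF.
Qed.

End Integrals.

Lemma continuous_eq0_closure (R : realType) (a b : R) (F : R -> R) : a < b ->
  (forall t, t \in `[a, b] -> {for t, continuous F}) ->
  (forall t, t \in `]a, b[ -> F t = 0) -> forall t, t \in `[a, b] -> F t = 0.
Proof.
move=> ab cF F0 t tI; apply/eqP; apply: contraT => Ft0.
have Fp : 0 < `|F t| by rewrite normr_gt0.
have n : \forall s \near t, `|F t - F s| < `|F t|.
  have nb : \forall y \near F t, `|F t - y| < `|F t|.
    by apply/nbhs_ballP; exists `|F t| => // y; rewrite -ball_normE.
  exact: (near_pull (cF t tI) nb).
have [r /= r0 rP] := (nbhs_ballP _ _).1 n.
pose d := Num.min 1 (r / (2 * (b - a))).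
have ba0 : 0 < b - a by rewrite subr_gt0.
have d0 : 0 < d by rewrite lt_min ltr01 divr_gt0 // mulr_gt0.
have d1 : d <= 1 by rewrite ge_min lexx.
have dr : d * (b - a) <= r / 2.
  have : d <= r / (2 * (b - a)) by rewrite ge_min lexx orbT.
  by rewrite ler_pdivlMr ?mulr_gt0 // => H; rewrite ler_pdivlMr // -mulrA (mulrC _ 2).
(* s lies on the way from t to the midpoint, hence inside, at distance below r of t. *)
pose s := t + ((a + b) / 2 - t) * d.
move: tI; rewrite in_itv /= => /andP [ta tb].
have sI : s \in `]a, b[.
  by rewrite in_itv /= /s; apply/andP; split; nra.
have sb : ball t r s.
  rewrite -ball_normE /= /s opprD addrA subrr add0r normrN ltr_norml.
  by apply/andP; split; nra.
by have := rP _ sb; rewrite /= (F0 s sI) subr0 ltxx.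
Qed.

(** * Smooth maps in charts *)

Section SmoothNear.
Context (R : realType).

Section OneChart.
Context (E : normedModType R) (M : topologicalType) (phi : chart E M).

Lemma chart_inv_dom u : (phi @` chart_dom phi) u -> chart_dom phi (chart_inv phi u).
Proof. by move=> [x dx <-]; rewrite chart_mapK. Qed.

Lemma chart_invK u : (phi @` chart_dom phi) u -> phi (chart_inv phi u) = u.
Proof. by move=> [x dx <-]; rewrite chart_mapK. Qed.

Lemma near_chart_image (A : set M) x : chart_dom phi x -> nbhs x A ->
  \forall u \near phi x, (phi @` (chart_dom phi `&` A)) u.
Proof.
move=> dx Ax.
have ix : (phi @` chart_dom phi) (phi x) by exists x.
have n1 : \forall u \near phi x, (phi @` chart_dom phi) u.
  exact: open_nbhs_nbhs (conj (chart_image_open phi) ix).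
have n2 : \forall u \near phi x, A (chart_inv phi u).
  have := chart_inv_continuous ix; rewrite /prop_for /continuous_at /= chart_mapK //.
  by apply.
apply: filterS2 n1 n2 => u iu Au.
by exists (chart_inv phi u); [split => //; exact: chart_inv_dom|exact: chart_invK].
Qed.

Lemma open_chart_image (A : set M) : open A -> open (phi @` (chart_dom phi `&` A)).
Proof.
move=> oA; rewrite openE => _ [x [dx Ax] <-]; apply: near_chart_image => //.
exact: open_nbhs_nbhs.
Qed.

End OneChart.

Section TwoCharts.
Context (E F : normedModType R) (M N : topologicalType).
Context (phi : chart E M) (psi : chart F N).
Implicit Types (f : M -> N).

(** The condition on domains and the smoothness may be checked on two different
    neighbourhoods. *)
Lemma smooth_nearP f x : smooth_near phi psi f x <->
  (\forall u \near phi x, (phi @` (chart_dom phi `&` f @^-1` chart_dom psi)) u) /\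
  smooth_at (chart_rep phi psi f) (phi x).
Proof.
split=> [[V [oV Vx VS sV]]|[nD [U [oU Ux sU]]]].
  split; first by apply: filterS (open_nbhs_nbhs (conj oV Vx)).
  by exists V.
pose D := phi @` (chart_dom phi `&` f @^-1` chart_dom psi).
exists (U `&` D^°); split.
- by apply: openI => //; exact: open_interior.
- by split.
- by move=> u [_ /interior_subset].
- by move=> n; apply: Ck_sub (sU n) => u [].
Qed.

Lemma smooth_near_smooth_at f x : smooth_near phi psi f x ->
  smooth_at (chart_rep phi psi f) (phi x).
Proof. by move/smooth_nearP => []. Qed.

Lemma smooth_near_dom f x : chart_dom phi x -> smooth_near phi psi f x ->
  chart_dom psi (f x).
Proof.
move=> dx /smooth_nearP [/nbhs_singleton [y [dy dfy] yx] _].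
by rewrite -(chart_mapK dx) -yx chart_mapK.
Qed.

Lemma chart_rep_at f x : chart_dom phi x -> chart_rep phi psi f (phi x) = psi (f x).
Proof. by move=> dx; rewrite /chart_rep /= chart_mapK. Qed.

Lemma smooth_near_cst c x : chart_dom phi x -> chart_dom psi c ->
  smooth_near phi psi (fun=> c) x.
Proof.
move=> dx dc; apply/smooth_nearP; split; last exact: smooth_at_cst.
by apply: near_chart_image => //; exact: nearW.
Qed.

End TwoCharts.

Section Compositions.
Context (E F K : normedModType R) (M N P : topologicalType).
Context (phi : chart E M) (psi : chart F N) (chi : chart K P).

(** Only near the point: away from the domains of the charts the inner chart need
    not cancel. *)
Lemma chart_rep_comp_near (f : M -> N) (g : N -> P) x :
  smooth_near phi psi f x ->
  \forall u \near phi x,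
    (chart_rep psi chi g \o chart_rep phi psi f) u = chart_rep phi chi (g \o f) u.
Proof.
move=> /smooth_nearP [nf _]; apply: filterS nf => _ [y [dy dfy] <-].
by rewrite /chart_rep /= chart_mapK // chart_mapK.
Qed.

Lemma smooth_near_comp (f : M -> N) (g : N -> P) x : chart_dom phi x ->
  smooth_near phi psi f x -> smooth_near psi chi g (f x) ->
  smooth_near phi chi (g \o f) x.
Proof.
move=> dx sf /smooth_nearP [ng sg].
have cE := chart_rep_comp_near g sf.
have /smooth_nearP [nf sfa] := sf.
apply/smooth_nearP; split; last first.
  apply: smooth_at_eq cE _; apply: smooth_at_comp => //.
  by rewrite chart_rep_at.
have := smooth_at_continuous sfa.
rewrite /prop_for /continuous_at chart_rep_at // => /(_ _ ng) /= ng'.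
apply: filterS2 nf ng' => _ [y [dy dfy] <-].
rewrite /= chart_rep_at // => -[z [dz dgz] zy].
by exists y => //; split => //=; rewrite -(chart_mapK dfy) -zy chart_mapK.
Qed.

Lemma chart_diff_comp (f : M -> N) (g : N -> P) x v : chart_dom phi x ->
  smooth_near phi psi f x -> smooth_near psi chi g (f x) ->
  chart_diff phi chi (g \o f) x v =
  chart_diff psi chi g (f x) (chart_diff phi psi f x v).
Proof.
move=> dx sf sg; rewrite /chart_diff.
have df := smooth_at_differentiable (smooth_near_smooth_at sf).
have dg : differentiable (chart_rep psi chi g) (chart_rep phi psi f (phi x)).
  by rewrite chart_rep_at //; exact: smooth_at_differentiable (smooth_near_smooth_at sg).
rewrite -(near_eq_diff (chart_rep_comp_near g sf)) ?(diff_comp df dg) /=.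
  by rewrite chart_rep_at.
exact: differentiable_comp.
Qed.

Lemma smooth_near_pair (f : M -> N) (g : M -> P) x : chart_dom phi x ->
  smooth_near phi psi f x -> smooth_near phi chi g x ->
  smooth_near phi (prod_chart psi chi) (fun y => (f y, g y)) x.
Proof.
move=> dx /smooth_nearP [nf sf] /smooth_nearP [ng sg].
apply/smooth_nearP; split.
  apply: filterS2 nf ng => _ [y [dy dfy] <-] [z [dz dgz] zy].
  exists y => //; split => //; split => //=.
  by rewrite -(chart_mapK dy) -zy chart_mapK.
exact: smooth_at_pair sf sg.
Qed.

End Compositions.

Section IdCharts.
Context (E F : normedModType R) (M : topologicalType).

Lemma smooth_near_id_chart (psi : chart F M) (f : E -> M) x :
  smooth_near (id_chart E) psi f x <->
  (\forall y \near x, chart_dom psi (f y)) /\ smooth_at (psi \o f) x.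
Proof.
split=> [/smooth_nearP [nf sf]|[nf sf]].
  by split=> //; apply: filterS nf => _ [y [_ dy] <-].
by apply/smooth_nearP; split=> //; apply: filterS nf => y dy; exists y.
Qed.

Lemma smooth_near_id_near (psi : chart F M) (f : E -> M) x :
  smooth_near (id_chart E) psi f x ->
  \forall y \near x, smooth_near (id_chart E) psi f y.
Proof.
move=> [V [oV Vx VS sV]].
by apply: filterS (open_nbhs_nbhs (conj oV Vx)) => y Vy; exists V.
Qed.

End IdCharts.

Section ChartMaps.
Context (E : normedModType R) (M : topologicalType).

Lemma smooth_near_chart_inv (phi : chart E M) x : chart_dom phi x ->
  smooth_near (id_chart E) phi (chart_inv phi) (phi x).
Proof.
move=> dx; have nx : \forall u \near phi x, (phi @` (chart_dom phi `&` setT)) u.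
  by apply: near_chart_image => //; exact: nearW.
apply/smooth_near_id_chart; split.
  by apply: filterS nx => _ [y [dy _] <-]; rewrite chart_mapK.
apply: smooth_at_eq (smooth_at_id _).
by apply: filterS nx => _ [y [dy _] <-] /=; rewrite chart_mapK.
Qed.

End ChartMaps.

Lemma smooth_near_smooth_at_id (E F : normedModType R) (f : E -> F) x :
  smooth_near (id_chart E) (id_chart F) f x <-> smooth_at f x.
Proof.
split=> [/smooth_near_id_chart [_ //]|sf]; apply/smooth_near_id_chart; split=> //.
exact: nearW.
Qed.

Section ManifoldCharts.
Context (E F : normedModType R) (M : manifoldType F) (N : topologicalType).

Lemma smooth_near_compat (x y z : M) :
  chart_dom (chart_at x) z -> chart_dom (chart_at y) z ->
  smooth_near (chart_at x) (chart_at y) id z.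
Proof.
move=> dx dy.
exists (chart_at x @` (chart_dom (chart_at x) `&` chart_dom (chart_at y))); split.
- by apply: open_chart_image; exact: chart_dom_open.
- by exists z.
- by [].
- exact: chart_at_compat.
Qed.

(** A tangent vector is read in the chart attached to its base point, so the chart
    has to change as the point moves along a curve. *)
Lemma smooth_near_change (phi : chart E N) (a b : M) (f : N -> M) x :
  chart_dom phi x -> chart_dom (chart_at b) (f x) ->
  smooth_near phi (chart_at a) f x -> smooth_near phi (chart_at b) f x.
Proof.
move=> dx db sf; have da := smooth_near_dom dx sf.
apply: (smooth_near_comp (psi := chart_at a) (g := id)) => //.
exact: smooth_near_compat.
Qed.

End ManifoldCharts.
End SmoothNear.

(** * The group law in the chart at the unit *)

Section LieSmooth.
Context (R : realType) (E F : normedModType R) (G : lieGroupType E) (N : topologicalType).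
Context (phi : chart F N).
Implicit Types (a b c : G) (f g : N -> G).

Lemma smooth_near_mul a b c f g x : chart_dom phi x ->
  smooth_near phi (chart_at a) f x -> smooth_near phi (chart_at b) g x ->
  chart_dom (chart_at c) (f x * g x)%g ->
  smooth_near phi (chart_at c) (fun y => f y * g y)%g x.
Proof.
move=> dx sf sg dc.
have sf' := smooth_near_change dx (chart_at_dom (f x)) sf.
have sg' := smooth_near_change dx (chart_at_dom (g x)) sg.
apply: (smooth_near_change (a := (f x * g x)%g)) => //.
exact: (smooth_near_comp dx (smooth_near_pair dx sf' sg') (lie_mul_smooth _ _)).
Qed.

Lemma smooth_near_inv a c f x : chart_dom phi x ->
  smooth_near phi (chart_at a) f x -> chart_dom (chart_at c) (f x)^-1%g ->
  smooth_near phi (chart_at c) (fun y => (f y)^-1)%g x.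
Proof.
move=> dx sf dc.
have sf' := smooth_near_change dx (chart_at_dom (f x)) sf.
apply: (smooth_near_change (a := ((f x)^-1)%g)) => //.
exact: (smooth_near_comp dx sf' (lie_inv_smooth _)).
Qed.

End LieSmooth.

Section LocalGroup.
Context (R : realType) (E : normedModType R) (G : lieGroupType E).

Lemma smooth_near_rmul (a c z h : G) : chart_dom (chart_at a) z ->
  chart_dom (chart_at c) (z * h)%g ->
  smooth_near (chart_at a) (chart_at c) (rmul h) z.
Proof.
move=> da dc; apply: (@smooth_near_mul _ _ _ _ _ (chart_at a) a h c id (fun=> h)) => //.
  exact: smooth_near_compat.
by apply: smooth_near_cst => //; exact: chart_at_dom.
Qed.

Notation psi := (chart_at (1%g : G)).
Notation iota := (chart_inv psi).

Definition chart_unit : E := psi 1%g.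
Definition local_mul (p : E * E) : E := psi (iota p.1 * iota p.2)%g.
Definition local_div (p : E * E) : E := psi (iota p.1 * (iota p.2)^-1)%g.

Local Notation e := chart_unit.

Lemma chart_inv_unit : iota e = 1%g.
Proof. by rewrite /chart_unit chart_mapK //; exact: chart_at_dom. Qed.

Lemma chart_inv_comp_smooth (D : normedModType R) (f : D -> E) x : f x = e ->
  smooth_at f x -> smooth_near (id_chart D) psi (iota \o f) x.
Proof.
move=> fx sf; apply: (smooth_near_comp (psi := id_chart E)) => //.
  exact/smooth_near_smooth_at_id.
by rewrite fx; apply: smooth_near_chart_inv; exact: chart_at_dom.
Qed.

Lemma near_chart_unit (A : set G) : nbhs (1%g : G) A ->
  \forall p \near e, (psi @` (chart_dom psi `&` A)) p.
Proof. by move=> nA; apply: near_chart_image => //; exact: chart_at_dom. Qed.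

Lemma local_mul_smooth_near :
  smooth_near (id_chart (E * E)%type) psi (fun p => iota p.1 * iota p.2)%g (e, e).
Proof.
apply: (smooth_near_mul (a := 1%g) (b := 1%g)) => //=.
- by apply: chart_inv_comp_smooth => //; exact: smooth_at_proj1.
- by apply: chart_inv_comp_smooth => //; exact: smooth_at_proj2.
- by rewrite chart_inv_unit mulg1; exact: chart_at_dom.
Qed.

Lemma local_div_smooth_near :
  smooth_near (id_chart (E * E)%type) psi (fun p => iota p.1 * (iota p.2)^-1)%g (e, e).
Proof.
apply: (smooth_near_mul (a := 1%g) (b := 1%g)) => //=.
- by apply: chart_inv_comp_smooth => //; exact: smooth_at_proj1.
- apply: (smooth_near_inv (a := 1%g)) => //=.
    by apply: chart_inv_comp_smooth => //; exact: smooth_at_proj2.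
  by rewrite chart_inv_unit invg1; exact: chart_at_dom.
- by rewrite chart_inv_unit invg1 mulg1; exact: chart_at_dom.
Qed.

Lemma local_mul_smooth : smooth_at local_mul (e, e).
Proof. by have /smooth_near_id_chart [] := local_mul_smooth_near. Qed.

Lemma local_div_smooth : smooth_at local_div (e, e).
Proof. by have /smooth_near_id_chart [] := local_div_smooth_near. Qed.

(** The curves gamma and gamma h0^-1 have the same trivialized velocity, because
    gamma(tau) gamma(t)^-1 is unchanged when gamma is multiplied on the right by a
    constant.  A suitable h0 brings the curve into the chart at the unit. *)
Lemma trivialized_velocityE (gamma : R -> G) (t : R) (h0 : G) :
  let v := (fun tau : R^o => psi (gamma tau * h0^-1)%g) in
  smooth_near (id_chart R^o) (chart_at (gamma t)) gamma t ->
  chart_dom psi (gamma t * h0^-1)%g ->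
  smooth_at local_div (v t, v t) ->
  trivialized_velocity gamma t = 'd local_div (v t, v t) ('d v t 1, 0).
Proof.
move=> v sg dt sd; rewrite /trivialized_velocity /rtrivialize /tangent_map /velocity.
have E1 : rmul (gamma t)^-1%g (gamma t) = 1%g by rewrite /rmul mulgV.
rewrite E1.
have snv : smooth_near (id_chart R^o) psi (fun tau => gamma tau * h0^-1)%g t.
  apply: (smooth_near_mul (a := gamma t) (b := h0^-1%g)) => //.
  by apply: smooth_near_cst => //; exact: chart_at_dom.
have /smooth_near_id_chart [nv sv] := snv.
rewrite -chart_diff_comp //; last first.
  by apply: smooth_near_rmul; [exact: chart_at_dom|rewrite mulgV; exact: chart_at_dom].
rewrite /chart_diff.
have dv := smooth_at_differentiable sv.
have dd := smooth_at_differentiable sd.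
have Ed : 'd (fun tau => local_div (v tau, v t)) t 1 = 'd local_div (v t, v t) ('d v t 1, 0).
  apply: etrans (@diff_comp_pair _ _ _ _ _ local_div v (fun=> v t) t 1 dd dv
    (@differentiable_cst _ R^o E (v t) t)) _.
  by rewrite (@diff_cst _ R^o E).
have nE : \forall tau \near (t : R^o), local_div (v tau, v t) =
    chart_rep (id_chart R^o) psi (rmul (gamma t)^-1%g \o gamma) tau.
  apply: filterS nv => tau dtau.
  by rewrite /local_div /chart_rep /v /= /rmul !chart_mapK // mulgKA.
have dp : differentiable (fun tau : R^o => local_div (v tau, v t)) t.
  exact: differentiable_comp (differentiable_pair dv (@differentiable_cst _ R^o E (v t) t)) dd.
by rewrite -Ed -(@near_eq_diff _ _ _ _ _ _ nE dp).
Qed.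

End LocalGroup.

(** * The right Maurer-Cartan form *)

Section MaurerCartan.
Context (R : realType) (E : normedModType R) (G : lieGroupType E).
Notation psi := (chart_at (1%g : G)).
Notation iota := (chart_inv psi).
Notation e := (chart_unit G).
Notation lmul := (@local_mul R E G).
Notation ldiv := (@local_div R E G).

(** T_p R_(p^-1) v in the chart at the unit, for q = (p, v). *)
Definition maurer_cartan (q : E * E) : E := 'd ldiv (q.1, q.1) (q.2, 0).
(** T_e R_p w in the chart at the unit. *)
Definition right_invariant (w p : E) : E := 'd lmul (e, p) (w, 0).

Local Notation mc := maurer_cartan.
Local Notation ri := right_invariant.

Lemma maurer_cartan_smooth v : smooth_at mc (e, v).
Proof.
apply: smooth_at_diff; first exact: local_div_smooth.
- by apply: smooth_at_pair; exact: smooth_at_proj1.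
- by apply: smooth_at_pair; [exact: smooth_at_proj2|exact: smooth_at_cst].
Qed.

Lemma right_invariant_smooth w : smooth_at (ri w) e.
Proof.
apply: smooth_at_diff; first exact: local_mul_smooth.
- by apply: smooth_at_pair; [exact: smooth_at_cst|exact: smooth_at_id].
- exact: smooth_at_cst.
Qed.

Lemma near_chart_inv_dom : \forall p \near e, chart_dom psi (iota p) /\ psi (iota p) = p.
Proof.
have n : \forall p \near e, (psi @` (chart_dom psi `&` setT)) p.
  exact: near_chart_unit filterT.
by apply: filterS n => _ [y [dy _] <-]; rewrite chart_mapK.
Qed.

Lemma maurer_cartan_linear p : linear (fun v => mc (p, v)).
Proof.
move=> k x y; rewrite /mc /=.
have -> : (k *: x + y, 0) = k *: (x, 0) + (y, 0) :> E * E.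
  by congr (_, _); rewrite /= scaler0 addr0.
by rewrite linearP.
Qed.

Lemma continuous_pair0 (D1 D2 : normedModType R) : continuous (fun v : D1 => (v, 0 : D2)).
Proof. by move=> v; apply: cvg_pair; [exact: cvg_id|exact: cvg_cst]. Qed.

Lemma maurer_cartan_continuous p : smooth_at ldiv (p, p) -> continuous (fun v => mc (p, v)).
Proof.
move=> /smooth_at_differentiable/diff_continuous cd x.
exact: (continuous_comp (@continuous_pair0 E E x) (cd _)).
Qed.

Lemma maurer_cartan_unit v : mc (e, v) = v.
Proof.
rewrite /mc /= -(diff_partial1 (f := ldiv)); last exact: smooth_at_differentiable (@local_div_smooth _ _ _).
rewrite -(@near_eq_diff _ _ _ id) ?diff_id //.
apply: filterS near_chart_inv_dom => p [dp pE].
by rewrite /local_div /= chart_inv_unit invg1 mulg1 pE.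
Qed.

Lemma right_invariant_unit w : ri w e = w.
Proof.
rewrite /ri /= -(diff_partial1 (f := lmul)); last exact: smooth_at_differentiable (@local_mul_smooth _ _ _).
rewrite -(@near_eq_diff _ _ _ id) ?diff_id //.
apply: filterS near_chart_inv_dom => p [dp pE].
by rewrite /local_mul /= chart_inv_unit mulg1 pE.
Qed.

(** The derivative at q = e of the identity (q p) p^-1 = q. *)
Lemma maurer_cartan_right_invariant w : \forall p \near e, mc (p, ri w p) = w.
Proof.
have n1 : \forall p \near e, smooth_at ldiv (p, p).
  apply: (near_pull (f := fun p : E => (p, p))).
    by apply/smooth_at_continuous/smooth_at_pair; exact: smooth_at_id.
  exact: smooth_at_near (@local_div_smooth _ _ _).
have cE : {for e, continuous (fun p : E => (e, p))}.
  by apply/smooth_at_continuous/smooth_at_pair; [exact: smooth_at_cst|exact: smooth_at_id].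
have n2 : \forall p \near e, smooth_at lmul (e, p).
  apply: (near_pull (f := fun p : E => (e, p))) => //.
  exact: smooth_at_near (@local_mul_smooth _ _ _).
have n3 : \forall p \near e, \forall q \near e, chart_dom psi (iota q * iota p)%g.
  have /smooth_near_id_chart [/near_join n _] := @local_mul_smooth_near R E G.
  have := near_pull cE n; apply: filterS => p /= np.
  apply: (near_pull (f := fun q : E => (q, p))) np.
  by apply/smooth_at_continuous/smooth_at_pair; [exact: smooth_at_id|exact: smooth_at_cst].
have n4 := near_chart_inv_dom.
near=> p.
have sd : smooth_at ldiv (p, p) by near: p.
have sm : smooth_at lmul (e, p) by near: p.
have nd : \forall q \near e, chart_dom psi (iota q * iota p)%g by near: p.
have [dp pE] : chart_dom psi (iota p) /\ psi (iota p) = p by near: p.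
have mE : lmul (e, p) = p by rewrite /local_mul /= chart_inv_unit mul1g.
have dd : differentiable ldiv (lmul (e, p), p).
  by rewrite mE; exact: smooth_at_differentiable.
have dm := smooth_at_differentiable sm.
have dm1 : differentiable (fun q => lmul (q, p)) e.
  have dp1 : differentiable (fun q : E => (q, p)) e.
    exact: (differentiable_pair (f := id) (g := fun=> p)).
  exact: (differentiable_comp (g := lmul) dp1 dm).
have -> : mc (p, ri w p) = 'd (fun q => ldiv (lmul (q, p), p)) e w.
  rewrite (diff_comp_pair (f := ldiv) (a := fun q => lmul (q, p)) (b := fun=> p)) //.
    by rewrite mE (@diff_cst _ E E) /mc /= /ri -(diff_partial1 (f := lmul)).
rewrite -(@near_eq_diff _ _ _ id) ?diff_id //.
apply: filterS2 nd near_chart_inv_dom => q dq [_ qE].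
by rewrite /local_div /local_mul /= chart_mapK // mulgK.
Unshelve. all: by end_near. Qed.

Lemma diff_maurer_cartan x y v : 'd mc (e, v) (x, y) = 'd mc (e, v) (x, 0) + y.
Proof.
have -> : (x, y) = (x, 0) + (0, y) :> E * E by congr (_, _); rewrite /= ?addr0 ?add0r.
rewrite linearD; congr (_ + _).
rewrite diff_linear2 ?maurer_cartan_unit //.
- exact: smooth_at_differentiable (maurer_cartan_smooth _).
- exact: maurer_cartan_linear.
- by apply: maurer_cartan_continuous; exact: local_div_smooth.
Qed.

(** The derivative at the unit of the identity omega(X_y) = y, where omega is the
    identity and X_y = y at the unit. *)
Lemma diff_maurer_cartan_right_invariant x y : 'd mc (e, y) (x, 0) = - 'd (ri y) e x.
Proof.
have dri := smooth_at_differentiable (right_invariant_smooth y).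
have : 'd (fun p => mc (p, ri y p)) e x = 0.
  rewrite -(@near_eq_diff _ _ _ (fun=> y)) //.
  - by rewrite (@diff_cst _ E E).
  - by apply: filterS (maurer_cartan_right_invariant y) => p ->.
rewrite (diff_comp_pair (f := mc) (a := id) (b := ri y)) //; last first.
  exact: smooth_at_differentiable (maurer_cartan_smooth _).
by rewrite diff_id right_invariant_unit diff_maurer_cartan => /eqP; rewrite addr_eq0 => /eqP.
Qed.

Lemma rtranslate_unit w : rtranslate (1%g : G) w = w.
Proof.
rewrite /rtranslate /tangent_map.
have -> : rmul (1%g : G) 1%g = 1%g by rewrite /rmul mulg1.
rewrite /chart_diff -(@near_eq_diff _ _ _ id) ?diff_id //.
apply: filterS near_chart_inv_dom => p [dp pE].
by rewrite /chart_rep /= /rmul mulg1 pE.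
Qed.

(** The value of the field at the point of coordinates p is first computed in the
    chart attached to that point and then read in the chart at the unit; by the
    chain rule only the latter chart remains. *)
Lemma field_rep_rtranslate w : \forall p \near e,
  field_rep (fun g : G => rtranslate g w) 1%g p = ri w p.
Proof.
have n2 : \forall p \near e, smooth_at lmul (e, p).
  apply: (near_pull (f := fun p : E => (e, p))) => //.
    by apply/smooth_at_continuous/smooth_at_pair; [exact: smooth_at_cst|exact: smooth_at_id].
  exact: smooth_at_near (@local_mul_smooth _ _ _).
apply: filterS2 n2 near_chart_inv_dom => p sm [dp pE].
rewrite /field_rep /=; set y := iota p in dp pE *.
rewrite /rtranslate /tangent_map.
have y1 : rmul y 1%g = y by rewrite /rmul mul1g.
rewrite [in chart_at (rmul _ _)]y1.
have d1 : chart_dom psi 1%g by exact: chart_at_dom.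
have s1 : smooth_near psi (chart_at y) (rmul y) 1%g.
  by apply: smooth_near_rmul => //; rewrite mul1g; exact: chart_at_dom.
have s2 : smooth_near (chart_at y) psi id (rmul y 1%g).
  by rewrite y1; apply: smooth_near_compat => //; exact: chart_at_dom.
have H := chart_diff_comp w d1 s1 s2; rewrite y1 in H.
rewrite [LHS](_ : _ = chart_diff psi psi (rmul y) 1%g w); last exact: esym H.
rewrite /chart_diff /ri -(diff_partial1 (f := lmul)) //.
exact: smooth_at_differentiable.
Qed.

(** The Maurer-Cartan equation at the unit: the differentials of right-invariant
    fields and of the form that is dual to them are opposite. *)
Lemma lie_bracketE (x y : E) :
  lie_bracket (G := G) x y = 'd mc (e, x) (y, 0) - 'd mc (e, y) (x, 0).
Proof.
rewrite /lie_bracket /jacobi_lie !rtranslate_unit.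
have dri w := smooth_at_differentiable (right_invariant_smooth w).
have ne w : \forall p \near e, ri w p = field_rep (fun g : G => rtranslate g w) 1%g p.
  by apply: filterS (field_rep_rtranslate w) => p ->.
by rewrite -!(near_eq_diff (ne _) (dri _)) !diff_maurer_cartan_right_invariant opprK addrC.
Qed.

End MaurerCartan.

(** * First variation of the Lagrangian *)

Section FirstVariation.
Context (R : realType) (E : normedModType R) (G : lieGroupType E).
Notation psi := (chart_at (1%g : G)).
Notation iota := (chart_inv psi).
Notation e := (chart_unit G).
Notation ldiv := (@local_div R E G).
Notation mc := (@maurer_cartan R E G).

Context (c : R -> R -> G) (t0 : R^o).
Let z0 : R^o * R^o := (0, t0).
Let h0 := c 0 t0.
Context (hc : smooth_near (id_chart (R^o * R^o)%type) (chart_at (c 0 t0))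
  (fun q : R^o * R^o => c q.1 q.2) (0, t0)).

(** The family translated on the right so that it passes through the unit at
    (0, t0), in the chart at the unit. *)
Definition centered (q : R^o * R^o) : E := psi (c q.1 q.2 * (c 0 t0)^-1)%g.
Local Notation u := centered.

Definition centered_ds (q : R^o * R^o) : E := 'd u q (1, 0).
Definition centered_dt (q : R^o * R^o) : E := 'd u q (0, 1).
Definition family_velocity q := mc (u q, centered_dt q).
Definition family_variation q := mc (u q, centered_ds q).

Lemma centered_smooth_near : smooth_near (id_chart (R^o * R^o)%type) psi
  (fun q : R^o * R^o => c q.1 q.2 * h0^-1)%g z0.
Proof.
apply: (smooth_near_mul (a := h0) (b := h0^-1%g)) => //.
- by apply: smooth_near_cst => //; exact: chart_at_dom.
- by rewrite /= mulgV; exact: chart_at_dom.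
Qed.

Lemma centered_smooth : smooth_at u z0.
Proof. by have /smooth_near_id_chart [] := centered_smooth_near. Qed.

Lemma centered_base : u z0 = e.
Proof. by rewrite /u /= mulgV. Qed.

Lemma centered_ds_smooth : smooth_at centered_ds z0.
Proof.
apply: smooth_at_diff; [exact: centered_smooth|exact: smooth_at_id|exact: smooth_at_cst].
Qed.

Lemma centered_dt_smooth : smooth_at centered_dt z0.
Proof.
apply: smooth_at_diff; [exact: centered_smooth|exact: smooth_at_id|exact: smooth_at_cst].
Qed.

Lemma maurer_cartan_comp_smooth (v : R^o * R^o -> E) : smooth_at v z0 ->
  smooth_at (fun q => mc (u q, v q)) z0.
Proof.
move=> sv; apply: (smooth_at_comp (g := mc) (smooth_at_pair centered_smooth sv)).
by rewrite centered_base; exact: maurer_cartan_smooth.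
Qed.

Lemma family_velocity_smooth : smooth_at family_velocity z0.
Proof. exact/maurer_cartan_comp_smooth/centered_dt_smooth. Qed.

Lemma family_variation_smooth : smooth_at family_variation z0.
Proof. exact/maurer_cartan_comp_smooth/centered_ds_smooth. Qed.

Lemma family_velocity_base : family_velocity z0 = centered_dt z0.
Proof. by rewrite /family_velocity centered_base maurer_cartan_unit. Qed.

Lemma family_variation_base : family_variation z0 = centered_ds z0.
Proof. by rewrite /family_variation centered_base maurer_cartan_unit. Qed.

Lemma diff_maurer_cartan_comp (v : R^o * R^o -> E) w : smooth_at v z0 ->
  'd (fun q => mc (u q, v q)) z0 w = 'd mc (e, v z0) ('d u z0 w, 0) + 'd v z0 w.
Proof.
move=> /smooth_at_differentiable dv.
have dm : differentiable mc (u z0, v z0).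
  by rewrite centered_base; exact: smooth_at_differentiable (maurer_cartan_smooth _ _).
apply: etrans (@diff_comp_pair _ _ _ _ _ mc u v z0 w dm
  (smooth_at_differentiable centered_smooth) dv) _.
by rewrite centered_base diff_maurer_cartan.
Qed.

(** The symmetry of mixed derivatives for the real function l o u. *)
Lemma linear_diff_symmetric (l : E -> R^o) : linear l -> continuous l ->
  l ('d centered_dt z0 (1, 0)) = l ('d centered_ds z0 (0, 1)).
Proof.
move=> ll cl.
have dl x : is_diff x l l by exact: is_diff_linear.
have dlu q w : differentiable u q -> 'd (l \o u) q w = l ('d u q w).
  move=> du; have [dlx lE] := dl (u q).
  by rewrite (diff_comp du dlx) /= lE.
have slu : smooth_at (l \o u) z0.
  by apply: smooth_at_comp; [exact: centered_smooth|exact: smooth_at_linear].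
have nu : \forall q \near z0, differentiable u q.
  by apply: filterS (smooth_at_near centered_smooth) => q /smooth_at_differentiable.
have dlv (v : R^o * R^o -> E) w : differentiable v z0 -> l ('d v z0 w) = 'd (l \o v) z0 w.
  move=> dv; have [dlx lE] := dl (v z0).
  by rewrite (diff_comp dv dlx) /= lE.
have dus := smooth_at_differentiable centered_ds_smooth.
have dut := smooth_at_differentiable centered_dt_smooth.
have cmp v : differentiable v z0 -> differentiable (l \o v) z0.
  by move=> dv; apply: differentiable_comp => //; have [] := dl (v z0).
have nt : \forall q \near z0, (l \o centered_dt) q = 'd (l \o u) q (0, 1).
  by apply: filterS nu => q du; rewrite dlu.
have ns : \forall q \near z0, (l \o centered_ds) q = 'd (l \o u) q (1, 0).
  by apply: filterS nu => q du; rewrite dlu.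
have Et : 'd (l \o centered_dt) z0 = 'd (fun q => 'd (l \o u) q (0, 1)) z0 :> (_ -> _).
  exact: near_eq_diff nt (cmp _ dut).
have Es : 'd (l \o centered_ds) z0 = 'd (fun q => 'd (l \o u) q (1, 0)) z0 :> (_ -> _).
  exact: near_eq_diff ns (cmp _ dus).
apply: etrans (dlv centered_dt _ dut) _; apply: etrans _ (esym (dlv centered_ds _ dus)).
apply: etrans (congr1 (fun k => k (1, 0)) Et) _.
apply: etrans _ (esym (congr1 (fun k => k (0, 1)) Es)).
exact: diff_symmetric.
Qed.

(** With omega the Maurer-Cartan form and u the family in the chart at the unit,
    xi = omega(du/dt) and eta = omega(du/ds); the mixed second derivatives of u
    cancel in d xi/ds - d eta/dt, which leaves the antisymmetrized differential of
    omega at the unit, that is the bracket. *)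
Lemma structure_equation (l : E -> R^o) : linear l -> continuous l ->
  l ('d family_velocity z0 (1, 0)) =
  l ('d family_variation z0 (0, 1)) +
  l (lie_bracket (G := G) (family_velocity z0) (family_variation z0)).
Proof.
move=> ll cl.
pose fM := GRing.isLinear.Build _ _ _ _ l ll.
pose L : {linear E -> R^o} := HB.pack l fM.
have lD x y : l (x + y) = l x + l y by exact: (linearD L).
have lN x : l (- x) = - l x by exact: (linearN L).
have Exi : 'd family_velocity z0 (1, 0) =
    'd mc (e, centered_dt z0) (centered_ds z0, 0) + 'd centered_dt z0 (1, 0).
  exact: diff_maurer_cartan_comp centered_dt_smooth.
have Eeta : 'd family_variation z0 (0, 1) =
    'd mc (e, centered_ds z0) (centered_dt z0, 0) + 'd centered_ds z0 (0, 1).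
  exact: diff_maurer_cartan_comp centered_ds_smooth.
have S := linear_diff_symmetric ll cl.
have arith (x y d : R) : x + d = (y + d) + (x - y) by rewrite [RHS]addrC addrA subrK.
rewrite Exi Eeta lie_bracketE family_velocity_base family_variation_base !lD lN S.
exact: arith.
Qed.

Lemma family_near : \forall q \near z0,
  [/\ smooth_near (id_chart (R^o * R^o)%type) (chart_at h0) (fun q : R^o * R^o => c q.1 q.2) q,
      chart_dom psi (c q.1 q.2 * h0^-1)%g, smooth_at u q & smooth_at ldiv (u q, u q)].
Proof.
have n1 := smooth_near_id_near hc.
have [n2 _] := (smooth_near_id_chart _ _ _).1 centered_smooth_near.
have n3 := smooth_at_near centered_smooth.
have n4 : \forall q \near z0, smooth_at ldiv (u q, u q).
  apply: (near_pull (f := fun q => (u q, u q))).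
    by apply/smooth_at_continuous/smooth_at_pair; exact: centered_smooth.
  by rewrite centered_base; exact: smooth_at_near (@local_div_smooth _ _ _).
by apply: filterS2 (filterI n1 n2) (filterI n3 n4) => q [? ?] [? ?].
Qed.

Lemma near_family_velocity : \forall q \near z0, trivialized_velocity (c q.1) q.2 = family_velocity q.
Proof.
apply: filterS family_near => -[s t] /= [sc dq su sl].
rewrite (@trivialized_velocityE _ _ _ (c s) t h0) //.
  rewrite /family_velocity /mc /=; congr ('d _ _ (_, _)).
  exact: diff_partial2 (smooth_at_differentiable su).
apply: (smooth_near_change (a := h0)) => //; first exact: chart_at_dom.
apply: (@smooth_near_comp _ _ _ _ _ _ _ (id_chart R^o) (id_chart (R^o * R^o)%type) _
  (fun w : R^o => (s, w)) (fun q : R^o * R^o => c q.1 q.2)) => //.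
exact/smooth_near_smooth_at_id/smooth_at_line2.
Qed.

Lemma near_family_variation : \forall q \near z0, trivialized_velocity (c^~ q.2) q.1 = family_variation q.
Proof.
apply: filterS family_near => -[s t] /= [sc dq su sl].
rewrite (@trivialized_velocityE _ _ _ (c^~ t) s h0) //.
  rewrite /family_variation /mc /=; congr ('d _ _ (_, _)).
  exact: diff_partial1 (smooth_at_differentiable su).
apply: (smooth_near_change (a := h0)) => //; first exact: chart_at_dom.
apply: (@smooth_near_comp _ _ _ _ _ _ _ (id_chart R^o) (id_chart (R^o * R^o)%type) _
  (fun w : R^o => (w, t)) (fun q : R^o * R^o => c q.1 q.2)) => //.
exact/smooth_near_smooth_at_id/smooth_at_line1.
Qed.

Section Lagrangian.
Context (L : G -> lie_algebra G -> R) (L_smooth : smooth_lagrangian L).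

(** The Lagrangian as a function of the translated point and of the velocity; the
    latter is invariant under right translations. *)
Definition centered_lagrangian (q : E * E) : R^o := L (iota q.1 * h0)%g q.2.
Local Notation Lc := centered_lagrangian.

Lemma centered_group_smooth : smooth_near (id_chart E) (chart_at h0) (fun p => iota p * h0)%g e.
Proof.
apply: (smooth_near_mul (a := 1%g) (b := h0)) => //.
- by apply: smooth_near_chart_inv; exact: chart_at_dom.
- by apply: smooth_near_cst => //; exact: chart_at_dom.
- by rewrite /= chart_inv_unit mul1g; exact: chart_at_dom.
Qed.

Lemma centered_lagrangian_smooth x : smooth_at Lc (e, x).
Proof.
apply/smooth_near_smooth_at_id.
have s1 : smooth_near (id_chart (E * E)%type) (chart_at h0)
    ((fun p => (iota p * h0)%g) \o fst) (e, x).
  apply: (smooth_near_comp (psi := id_chart E)) => //.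
    exact/smooth_near_smooth_at_id/smooth_at_proj1.
  exact: centered_group_smooth.
have s2 : smooth_near (id_chart (E * E)%type) (id_chart E) snd (e, x).
  exact/smooth_near_smooth_at_id/smooth_at_proj2.
have s3 := smooth_near_pair (I : chart_dom (id_chart (E * E)%type) (e, x)) s1 s2.
apply: (smooth_near_comp (g := fun p : G * lie_algebra G => L p.1 p.2) _ s3) => //.
by rewrite /= chart_inv_unit mul1g; exact: L_smooth.
Qed.

Definition lagrangian_family (q : R^o * R^o) : R^o :=
  L (c q.1 q.2) (trivialized_velocity (c q.1) q.2).

Lemma near_lagrangian_family :
  \forall q \near z0, Lc (u q, family_velocity q) = lagrangian_family q.
Proof.
apply: filterS2 family_near near_family_velocity => q [_ dq _ _] xE.
by rewrite /Lc /lagrangian_family /= xE /u chart_mapK // mulgVK.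
Qed.

Lemma centered_lagrangian_family_smooth : smooth_at (fun q => Lc (u q, family_velocity q)) z0.
Proof.
apply: (smooth_at_comp (g := Lc) (smooth_at_pair centered_smooth family_velocity_smooth)).
by rewrite centered_base; exact: centered_lagrangian_smooth.
Qed.

Lemma lagrangian_family_smooth : smooth_at lagrangian_family z0.
Proof. exact: smooth_at_eq near_lagrangian_family centered_lagrangian_family_smooth. Qed.

Lemma near_dL_dxi : \forall q \near z0, forall x,
  dL_dxi L (c q.1 q.2) (trivialized_velocity (c q.1) q.2) x = 'd Lc (u q, family_velocity q) (0, x).
Proof.
have n : \forall q \near z0, smooth_at Lc (u q, family_velocity q).
  apply: (near_pull (f := fun q => (u q, family_velocity q))).
    by apply/smooth_at_continuous/smooth_at_pair; [exact: centered_smooth|exact: family_velocity_smooth].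
  by rewrite centered_base; exact: smooth_at_near (centered_lagrangian_smooth _).
apply: filterS3 n family_near near_family_velocity => q sL [_ dq _ _] xE x.
have LE : (fun z => Lc (u q, z)) = L (c q.1 q.2).
  by apply/funext => z; rewrite /Lc /u /= chart_mapK // mulgVK.
apply: etrans _ (@diff_partial2 _ _ _ _ Lc (u q) (family_velocity q) x (smooth_at_differentiable sL)).
by rewrite LE xE.
Qed.

Lemma rtranslate_dual_dL_dg xi x :
  rtranslate_dual h0 (dL_dg L h0 xi) x = 'd Lc (e, xi) (x, 0).
Proof.
rewrite /rtranslate_dual /dL_dg /differential /rtranslate /tangent_map.
have h1 : rmul h0 1%g = h0 by rewrite /rmul mul1g.
have d1 : chart_dom psi 1%g by exact: chart_at_dom.
have s1 : smooth_near psi (chart_at h0) (rmul h0) 1%g.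
  by apply: smooth_near_rmul => //; rewrite mul1g; exact: chart_at_dom.
have s2 : smooth_near (chart_at h0) (id_chart R^o) (fun k => L k xi) (rmul h0 1%g).
  rewrite h1.
  have dh : chart_dom (chart_at h0) h0 by exact: chart_at_dom.
  have s3 : smooth_near (chart_at h0) (prod_chart (chart_at h0) (id_chart E))
      (fun k => (k, xi)) h0.
    apply: smooth_near_pair => //; first exact: smooth_near_compat.
    exact: smooth_near_cst.
  exact: (smooth_near_comp dh s3 (L_smooth _ _)).
have H := chart_diff_comp x d1 s1 s2; rewrite h1 in H; rewrite h1.
apply: etrans (esym H) _.
exact: (@diff_partial1 _ _ _ _ Lc e xi x (smooth_at_differentiable (centered_lagrangian_smooth _))).
Qed.

(** The chain rule for L, with the variation of xi replaced according to the
    structure equation for the linear form dL/dxi. *)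
Theorem first_variation :
  let xi := trivialized_velocity (c 0) t0 in
  let eta := (fun t : R^o => trivialized_velocity (c^~ t) 0) in
  'd lagrangian_family (0, t0) (1, 0) =
  dL_dxi L (c 0 t0) xi ('d eta t0 1) +
  (rtranslate_dual (c 0 t0) (dL_dg L (c 0 t0) xi) (eta t0) +
   ad_dual xi (dL_dxi L (c 0 t0) xi) (eta t0)).
Proof.
move=> xi eta.
have xiE : xi = family_velocity z0 by have := nbhs_singleton near_family_velocity.
have etaE : eta t0 = family_variation z0 by have := nbhs_singleton near_family_variation.
have ne : \forall t \near t0, family_variation (0, t) = eta t.
  have := near_pull (smooth_at_continuous (smooth_at_line2 0 t0)) near_family_variation.
  by apply: filterS => t /= tE; exact: esym tE.
have deta : differentiable (fun t : R^o => family_variation (0, t)) t0.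
  apply: smooth_at_differentiable; apply: (smooth_at_comp (g := family_variation) (smooth_at_line2 0 t0)).
  exact: family_variation_smooth.
have Eeta : 'd eta t0 1 = 'd family_variation z0 (0, 1).
  apply: etrans (congr1 (fun k => k 1) (esym (near_eq_diff ne deta))) _.
  exact: (@diff_partial2 _ _ _ _ family_variation 0 t0 1 (smooth_at_differentiable family_variation_smooth)).
have dL x : dL_dxi L (c 0 t0) xi x = 'd Lc (e, family_velocity z0) (0, x).
  by have := nbhs_singleton near_dL_dxi x; rewrite centered_base.
have dLc : differentiable Lc (u z0, family_velocity z0).
  by rewrite centered_base; exact: smooth_at_differentiable (centered_lagrangian_smooth _).
have Ef : 'd lagrangian_family z0 (1, 0) = 'd Lc (e, family_velocity z0) (family_variation z0, 'd family_velocity z0 (1, 0)).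
  apply: etrans (congr1 (fun k => k (1, 0)) (esym (near_eq_diff near_lagrangian_family
    (smooth_at_differentiable centered_lagrangian_family_smooth)))) _.
  apply: etrans (@diff_comp_pair _ _ _ _ _ Lc u family_velocity z0 (1, 0) dLc
    (smooth_at_differentiable centered_smooth) (smooth_at_differentiable family_velocity_smooth)) _.
  by rewrite centered_base family_variation_base.
have split0 (x y : E) : 'd Lc (e, family_velocity z0) (x, y) =
    'd Lc (e, family_velocity z0) (x, 0) + 'd Lc (e, family_velocity z0) (0, y).
  rewrite -linearD; congr ('d _ _ _).
  by congr (_, _); rewrite /= ?addr0 ?add0r.
rewrite Ef Eeta dL /ad_dual dL rtranslate_dual_dL_dg etaE xiE.
apply: etrans (split0 _ _) _.
pose l x : R^o := 'd Lc (e, family_velocity z0) (0, x).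
have ll : linear l.
  move=> k x y; rewrite /l.
  have -> : (0, k *: x + y) = k *: (0, x) + (0, y) :> E * E.
    by congr (_, _); rewrite /= scaler0 addr0.
  by rewrite linearP.
have cl : continuous l.
  have := diff_continuous (smooth_at_differentiable (centered_lagrangian_smooth (family_velocity z0))) => cd x.
  have c0 : {for x, continuous (fun x : E => (0 : E, x))}.
    by apply/smooth_at_continuous/smooth_at_pair; [exact: smooth_at_cst|exact: smooth_at_id].
  exact: (continuous_comp c0 (cd _)).
have S := structure_equation ll cl.
have arith (x y d w : R) : y = d + w -> x + y = d + (x + w).
  by move=> ->; rewrite addrCA.
exact: arith S.
Qed.

Lemma trivialized_variation_smooth :
  smooth_at (fun t : R^o => trivialized_velocity (c^~ t) 0 : E) t0.
Proof.
apply: (smooth_at_eq (f := fun t : R^o => family_variation (0, t))).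
  have := near_pull (smooth_at_continuous (smooth_at_line2 0 t0)) near_family_variation.
  by apply: filterS => t /= tE; exact: esym tE.
by apply: (smooth_at_comp (g := family_variation) (smooth_at_line2 0 t0)); exact: family_variation_smooth.
Qed.

Lemma momentum_smooth (x : E) : smooth_at
  (fun p : R^o * E => dL_dxi L (c 0 p.1) (trivialized_velocity (c 0) p.1) p.2 : R^o) (t0, x).
Proof.
have sl : smooth_at (fun p : R^o * E => (0 : R^o, p.1)) (t0, x).
  by apply: smooth_at_pair; [exact: smooth_at_cst|exact: smooth_at_proj1].
apply: (smooth_at_eq (f := fun p : R^o * E => 'd Lc (u (0, p.1), family_velocity (0, p.1)) (0, p.2))).
  have := near_pull (smooth_at_continuous sl) near_dL_dxi.
  by apply: filterS => p /(_ p.2) /= ->.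
apply: smooth_at_diff.
- by rewrite /= centered_base; exact: centered_lagrangian_smooth.
- apply: (smooth_at_comp (g := fun q => (u q, family_velocity q)) sl).
  by apply: smooth_at_pair; [exact: centered_smooth|exact: family_velocity_smooth].
- by apply: smooth_at_pair; [exact: smooth_at_cst|exact: smooth_at_proj2].
Qed.

End Lagrangian.
End FirstVariation.

(** * The residual of the Euler-Lagrange equation *)

Section EulerLagrange.
Context (R : realType) (E : normedModType R) (G : lieGroupType E).
Context (L : G -> lie_algebra G -> R) (L_smooth : smooth_lagrangian L).
Notation psi := (chart_at (1%g : G)).
Notation e := (chart_unit G).

Definition momentum (g : R -> G) (p : R^o * E) : R^o :=
  dL_dxi L (g p.1) (trivialized_velocity g p.1) p.2.

(** The right-hand side of the Euler-Lagrange equation, evaluated on x. *)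
Definition force (g : R -> G) (t : R) (x : E) : R :=
  let xi := trivialized_velocity g t in
  rtranslate_dual (g t) (dL_dg L (g t) xi) x + ad_dual xi (dL_dxi L (g t) xi) x.

(** The force minus the time derivative of the momentum, evaluated on x. *)
Definition residual (g : R -> G) (t : R) (x : E) : R :=
  force g t x - 'd (momentum g) (t, x) (1, 0).

Lemma lie_bracketZ (x y : E) (k : R) :
  lie_bracket (G := G) x (k *: y) = k *: lie_bracket (G := G) x y.
Proof.
rewrite !lie_bracketE scalerBr; congr (_ - _).
  have -> : (k *: y, 0) = k *: (y, 0) :> E * E by congr (_, _); rewrite /= scaler0.
  by rewrite linearZ.
apply: diff_partial1_homog; [exact: smooth_at_differentiable (maurer_cartan_smooth _ _)..|].
move=> z; have := @maurer_cartan_linear R E G z k y 0; rewrite !addr0 => ->.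
have -> : maurer_cartan G (z, 0) = 0; last by rewrite addr0.
by rewrite /maurer_cartan /= -[X in 'd _ _ X]/(0 : E * E) linear0.
Qed.

Lemma forceZ g t (k : R) x : force g t (k *: x) = k * force g t x.
Proof.
rewrite /force mulrDr; congr (_ + _); last by rewrite /ad_dual lie_bracketZ /dL_dxi linearZ.
rewrite /rtranslate_dual /dL_dg /differential /rtranslate /tangent_map /chart_diff.
by rewrite !linearZ.
Qed.

Section Family.
Context (c : R -> R -> G) (t : R).
Context (hc : smooth_near (id_chart (R^o * R^o)%type) (chart_at (c 0 t))
  (fun q : R^o * R^o => c q.1 q.2) (0, t)).

Lemma momentum_smooth_at x : smooth_at (momentum (c 0)) (t, x).
Proof. exact: (momentum_smooth hc L_smooth). Qed.

Lemma momentum_linear g s : linear (fun x => momentum g (s, x)).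
Proof. by move=> k x y; rewrite /momentum /dL_dxi /= linearP. Qed.

(** The momentum has a derivative for the dual norm by smoothness, and this
    derivative is computed vector by vector. *)
Lemma euler_lagrangeP :
  trivialized_euler_lagrange L (c 0) t <-> forall x, residual (c 0) t x = 0.
Proof.
have D := is_dual_derivative_smooth momentum_smooth_at (momentum_linear (c 0)).
split=> [H x|H].
  apply/eqP; rewrite subr_eq0; apply/eqP.
  exact: (is_dual_derivative_unique H D).
rewrite /trivialized_euler_lagrange.
rewrite [X in is_dual_derivative _ _ X](_ : _ = (fun x => 'd (momentum (c 0)) (t, x) (1, 0))) //.
by apply/funext => x; apply/eqP; rewrite -subr_eq0; apply/eqP; exact: H.
Qed.

Lemma residualZ (k : R) x : residual (c 0) t (k *: x) = k * residual (c 0) t x.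
Proof.
rewrite /residual forceZ mulrBr; congr (_ - _).
apply: diff_partial1_homog; [exact: smooth_at_differentiable (momentum_smooth_at _)..|].
by move=> z; rewrite /momentum /dL_dxi /= linearZ.
Qed.

Definition trivialized_variation (s : R^o) : E := trivialized_velocity (c^~ s) 0.

Definition paired_momentum (s : R^o) : R^o := momentum (c 0) (s, trivialized_variation s).

Lemma paired_momentum_smooth : smooth_at paired_momentum t.
Proof.
apply: (smooth_at_comp (f := fun s => (s, trivialized_variation s)) (g := momentum (c 0))).
  apply: smooth_at_pair; first exact: smooth_at_id.
  exact: (trivialized_variation_smooth hc).
exact: momentum_smooth_at.
Qed.

(** The Leibniz rule for the pairing of the momentum with the variation eta: the
    term with d eta/dt in the first variation becomes a total derivative. *)
Lemma lagrangian_variation :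
  'd (lagrangian_family c L) (0, t) (1, 0) =
  'd paired_momentum t 1 + residual (c 0) t (trivialized_variation t).
Proof.
have FV := first_variation hc L_smooth.
have deta := smooth_at_differentiable (trivialized_variation_smooth hc).
have dmom x := smooth_at_differentiable (momentum_smooth_at x).
have Eq : 'd paired_momentum t 1 = 'd (momentum (c 0)) (t, trivialized_variation t)
    (1, 'd trivialized_variation t 1).
  apply: etrans (@diff_comp_pair _ _ _ _ _ (momentum (c 0)) id trivialized_variation t 1
    (dmom _) _ deta) _ => //.
  by rewrite diff_id.
have Es (x y : E) : 'd (momentum (c 0)) (t, x) (1, y) =
    'd (momentum (c 0)) (t, x) (1, 0) + momentum (c 0) (t, y).
  have <- : 'd (momentum (c 0)) (t, x) (0, y) = momentum (c 0) (t, y).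
    apply: diff_linear2 => //; first exact: momentum_linear.
    move=> z; apply: (@smooth_at_continuous _ _ _ (fun z => momentum (c 0) (t, z))).
    apply: (smooth_at_comp (f := fun z => (t : R^o, z)) (g := momentum (c 0))).
      by apply: smooth_at_pair; [exact: smooth_at_cst|exact: smooth_at_id].
    exact: momentum_smooth_at.
  rewrite -linearD; congr ('d _ _ _).
  by congr (_, _); rewrite /= ?addr0 ?add0r.
have arith (x y z : R) : y + z = x + y + (z - x).
  by rewrite [x + y]addrC -addrA [x + _]addrC subrK.
rewrite Eq Es; apply: etrans FV _; exact: arith.
Qed.

End Family.

Lemma near_trivialized_velocity (g1 g2 : R -> G) (t : R) : curve_smooth_near g1 t ->
  (\forall s \near t, g1 s = g2 s) -> trivialized_velocity g1 t = trivialized_velocity g2 t.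
Proof.
move=> sg g12; have g12t := nbhs_singleton g12.
have sf := smooth_near_smooth_at sg.
have nE : \forall s \near t, chart_rep (id_chart R^o) (chart_at (g1 t)) g1 s =
    chart_rep (id_chart R^o) (chart_at (g1 t)) g2 s.
  by apply: filterS g12 => s sE; rewrite /chart_rep /= sE.
have dE := @near_eq_diff R R^o E _ _ t nE (smooth_at_differentiable sf).
have vE v : chart_diff (id_chart R^o) (chart_at (g1 t)) g1 t v =
    chart_diff (id_chart R^o) (chart_at (g1 t)) g2 t v.
  by rewrite /chart_diff dE.
by rewrite /trivialized_velocity /rtrivialize /tangent_map /velocity -g12t vE.
Qed.

(** A variation of g agrees with g on [a, b] only, so its equation can be compared
    with the one of g at interior points, where the two germs coincide. *)
Lemma near_euler_lagrange (g1 g2 : R -> G) (t : R) : curve_smooth_near g1 t ->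
  (\forall s \near t, g1 s = g2 s) ->
  trivialized_euler_lagrange L g1 t -> trivialized_euler_lagrange L g2 t.
Proof.
move=> sg g12.
have nsg : \forall s \near t, curve_smooth_near g1 s.
  apply: filterS (smooth_near_id_near sg) => s ss.
  by apply: smooth_near_change ss => //; exact: chart_at_dom.
have nv : \forall s \near t, g1 s = g2 s /\ trivialized_velocity g1 s = trivialized_velocity g2 s.
  have g12' := near_join g12.
  apply: filterS2 nsg g12' => s ss gs; split; first exact: nbhs_singleton gs.
  exact: near_trivialized_velocity.
have [gt vt] := nbhs_singleton nv.
have nv0 : \forall h \near (0 : R), g1 (t + h) = g2 (t + h) /\
    trivialized_velocity g1 (t + h) = trivialized_velocity g2 (t + h).
  have := nv; rewrite (near_shift 0) subr0 /=.
  by apply: filterS => h /=; rewrite addrC.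
rewrite /trivialized_euler_lagrange /= -gt -vt => H eps eps0.
apply: filterS2 nv0 (H eps eps0) => h [gh vh] Hh x.
by rewrite -gh -vh -gt -vt; exact: Hh x.
Qed.

Section Translation.
Context (g : R -> G) (w : E) (chi : R^o -> R^o).

(** The point of coordinates e + s chi(t) w stands for the exponential of
    s chi(t) w: both have derivative chi(t) w at s = 0, which is then the
    trivialized variation of the family. *)
Definition translated_family (s t : R) : G :=
  (chart_inv psi (e + (s * chi t) *: w) * g t)%g.

Lemma translated_family0 : translated_family 0 = g.
Proof.
apply/funext => t.
by rewrite /translated_family mul0r scale0r addr0 chart_inv_unit mul1g.
Qed.

Context (t : R) (sg : curve_smooth_near g t) (schi : smooth_at chi t).

Lemma displacement_smooth : smooth_at (fun q : R^o * R^o => e + (q.1 * chi q.2) *: w) (0, t).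
Proof.
apply: smooth_at_add; first exact: smooth_at_cst.
apply: smooth_at_scale; last exact: smooth_at_cst.
apply: (smooth_at_scale (k := fun q : R^o * R^o => q.1) (f := fun q : R^o * R^o => chi q.2)).
  exact: smooth_at_proj1.
by apply: (smooth_at_comp (g := chi) (@smooth_at_proj2 _ _ _ _)).
Qed.

Lemma translated_family_smooth :
  smooth_near (id_chart (R^o * R^o)%type) (chart_at (translated_family 0 t))
    (fun q : R^o * R^o => translated_family q.1 q.2) (0, t).
Proof.
apply: (smooth_near_mul (a := 1%g) (b := g t)) => //; last exact: chart_at_dom.
  apply: (@chart_inv_comp_smooth _ _ _ _ (fun q : R^o * R^o => e + (q.1 * chi q.2) *: w)).
    by rewrite /= mul0r scale0r addr0.
  exact: displacement_smooth.
apply: (@smooth_near_comp _ _ _ _ _ _ _ _ (id_chart R^o) _ (snd : R^o * R^o -> R^o) g) => //.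
exact/smooth_near_smooth_at_id/smooth_at_proj2.
Qed.

Lemma translated_variation : trivialized_variation translated_family t = chi t *: w.
Proof.
pose d (s : R^o) : E := e + (s * chi t) *: w.
have sd : smooth_at d 0.
  apply: smooth_at_add; first exact: smooth_at_cst.
  apply: smooth_at_scale; last exact: smooth_at_cst.
  apply: (smooth_at_scale (k := fun q : R^o => q) (f := fun q : R^o => chi t)).
    exact: smooth_at_id.
  exact: smooth_at_cst.
have d0 : d 0 = e by rewrite /d mul0r scale0r addr0.
have g0 : translated_family 0 t = g t by rewrite translated_family0.
have hs := @chart_inv_comp_smooth _ _ G _ d 0 d0 sd.
have sc : smooth_near (id_chart R^o) (chart_at (translated_family 0 t)) (translated_family^~ t) 0.
  apply: (smooth_near_mul (a := 1%g) (b := g t)) => //; last exact: chart_at_dom.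
  by apply: smooth_near_cst => //; exact: chart_at_dom.
rewrite /trivialized_variation.
have sl : smooth_at (@local_div R E G) (e, e) by exact: local_div_smooth.
have vE s : psi (translated_family s t * (g t)^-1)%g = psi (chart_inv psi (d s)).
  by rewrite /translated_family mulgK.
have v0 : psi (translated_family 0 t * (g t)^-1)%g = e.
  by rewrite vE d0 chart_inv_unit.
rewrite (@trivialized_velocityE _ _ _ _ _ (g t)) ?v0 //; last first.
  by rewrite g0 mulgV; exact: chart_at_dom.
apply: etrans (maurer_cartan_unit _ _) _.
have [nd _] := (smooth_near_id_chart _ _ _).1 hs.
have nE : \forall s \near (0 : R^o), d s = psi (translated_family s t * (g t)^-1)%g.
  have := near_pull (smooth_at_continuous sd).
  rewrite d0 => /(_ _ (@near_chart_inv_dom R E G)).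
  by apply: filterS => s [_ sE]; rewrite vE sE.
apply: etrans (congr1 (fun k => k 1) (esym (near_eq_diff nE (smooth_at_differentiable sd)))) _.
have lE : d = (fun s : R^o => cst e s + s *: (chi t *: w)).
  by apply/funext => s; rewrite /d scalerA.
rewrite lE.
have : is_diff (0 : R^o) (cst e + *:%R^~ (chi t *: w)) (0 + *:%R^~ (chi t *: w)).
  exact: is_diffD.
case=> _ ->; rewrite /= fctE /=.
by rewrite [X in X + _](_ : _ = 0) // add0r scale1r.
Qed.

Lemma translated_variation_field0 : chi t = 0 -> variation_field translated_family t = 0.
Proof.
move=> chi0; rewrite /variation_field /velocity /chart_diff.
have -> : translated_family^~ t = fun=> translated_family 0 t.
  by apply/funext => s; rewrite /translated_family chi0 !mulr0.
rewrite [chart_rep _ _ _](_ : _ = cst (chart_at (translated_family 0 t) (translated_family 0 t))) //.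
by rewrite (@diff_cst _ R^o E).
Qed.

End Translation.
End EulerLagrange.

(** * First variation of the action *)

Section ActionVariation.
Context (R : realType) (E : normedModType R) (G : lieGroupType E).
Context (L : G -> lie_algebra G -> R) (L_smooth : smooth_lagrangian L).
Context (a b : R) (ab : a < b).
Local Notation mu := (@lebesgue_measure R).

Definition smooth_family (c : R -> R -> G) : Prop :=
  forall t, t \in `[a, b] -> smooth_near (id_chart (R^o * R^o)%type)
    (chart_at (c 0 t)) (fun q : R^o * R^o => c q.1 q.2) (0, t).

(** The part of the variation of the Lagrangian that is not a total derivative. *)
Definition variation_density (c : R -> R -> G) (t : R^o) : R^o :=
  'd (lagrangian_family c L) (0, t) (1, 0) - 'd (paired_momentum L c) t 1.

Lemma variation_densityE c t : smooth_family c -> t \in `[a, b] ->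
  variation_density c t = residual L (c 0) t (trivialized_variation c t).
Proof.
move=> hc tI; rewrite /variation_density.
by rewrite (lagrangian_variation L_smooth (hc t tI)) addrAC subrr add0r.
Qed.

Lemma lagrangian_rate_smooth c t : smooth_family c -> t \in `[a, b] ->
  smooth_at (fun t : R^o => 'd (lagrangian_family c L) (0, t) (1, 0) : R^o) t.
Proof.
move=> hc tI; apply: smooth_at_diff.
- exact: (lagrangian_family_smooth (hc t tI) L_smooth).
- exact: smooth_at_line2.
- exact: smooth_at_cst.
Qed.

Lemma momentum_rate_smooth c t : smooth_family c -> t \in `[a, b] ->
  smooth_at (fun t : R^o => 'd (paired_momentum L c) t 1 : R^o) t.
Proof.
move=> hc tI; apply: smooth_at_diff.
- exact: (paired_momentum_smooth L_smooth (hc t tI)).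
- exact: smooth_at_id.
- exact: smooth_at_cst.
Qed.

Lemma variation_density_smooth c t : smooth_family c -> t \in `[a, b] ->
  smooth_at (variation_density c) t.
Proof.
move=> hc tI; apply: smooth_at_sub; first exact: lagrangian_rate_smooth.
exact: momentum_rate_smooth.
Qed.

(** The total derivative contributes the difference of the values of <p, eta> at the
    end points, where eta vanishes. *)
Lemma action_variation c : smooth_family c ->
  trivialized_variation c a = 0 -> trivialized_variation c b = 0 ->
  is_derive (0 : R) (1 : R) (fun s => action L a b (c s) : R^o)
    (\int[mu]_(t in [set` `[a, b]]) (variation_density c t : R))%R.
Proof.
move=> hc eta_a eta_b.
have D : is_derive (0 : R) (1 : R) (fun s => action L a b (c s) : R^o)
    (\int[mu]_(t in [set` `[a, b]]) ('d (lagrangian_family c L) (0, t) (1, 0) : R))%R.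
  apply: (@is_derive_Rintegral _ a b (lagrangian_family c L)) => t tI.
  exact: (lagrangian_family_smooth (hc t tI) L_smooth).
suff <- : (\int[mu]_(t in [set` `[a, b]]) ('d (lagrangian_family c L) (0, t) (1, 0) : R))%R =
  (\int[mu]_(t in [set` `[a, b]]) (variation_density c t : R))%R by [].
have cts (f : R^o -> R^o) : (forall t, t \in `[a, b] -> smooth_at f t) ->
    mu.-integrable `[a, b] (EFin \o (f : R -> R)).
  by move=> sf; apply: integrable_continuous_itv => t /sf/smooth_at_continuous.
have I1 := cts _ (fun t => @momentum_rate_smooth c t hc).
have I2 := cts _ (fun t => @variation_density_smooth c t hc).
have I0 : (\int[mu]_(t in [set` `[a, b]]) ('d (paired_momentum L c) t 1 : R))%R = 0.
  rewrite (Rintegral_diff ab); last first.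
    by move=> t tI; exact: (paired_momentum_smooth L_smooth (hc t tI)).
  have mom0 s : momentum L (c 0) (s, 0) = 0 by exact: linear0.
  by rewrite /paired_momentum eta_a eta_b !mom0 subrr.
have arith (x y : R) : x = y + (x - y) by rewrite addrC subrK.
apply: etrans (eq_Rintegral _ _) _; last apply: etrans (RintegralD _ I1 I2) _ => //.
  by move=> t _; exact: arith.
by rewrite I0 add0r.
Qed.

(** The density <r, eta> is 0 in the interior because r = 0 there, and at the end
    points because eta = 0. *)
Lemma stationary_of_euler_lagrange (g : R -> G) : smooth_curve a b g ->
  (forall t, t \in `[a, b] -> trivialized_euler_lagrange L g t) ->
  stationary L a b g.
Proof.
move=> sg EL c [hc cg va vb].
have eta0 t : variation_field c t = 0 -> trivialized_variation c t = 0.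
  move=> v0; rewrite /trivialized_variation /trivialized_velocity.
  rewrite -[velocity _ _]/(variation_field c t) v0.
  by rewrite /rtrivialize /tangent_map /chart_diff linear0.
have ea := eta0 _ va; have eb := eta0 _ vb.
suff I0 : (\int[mu]_(t in [set` `[a, b]]) (variation_density c t : R))%R = 0.
  by have := action_variation hc ea eb; rewrite I0.
have res0 t : t \in `[a, b] -> trivialized_variation c t = 0 -> variation_density c t = 0.
  move=> tI et; rewrite variation_densityE // et -(scale0r (0 : E)).
  by rewrite (residualZ L_smooth (hc t tI)) mul0r.
have E0 t : t \in `[a, b] -> variation_density c t = 0.
  move=> tI; have := tI; rewrite in_itv /= => /andP [ta tb].
  have [at_|ta'] := eqVneq t a; first by move: tI; rewrite at_ => aI; exact: res0 aI ea.
  have [bt_|tb'] := eqVneq t b; first by move: tI; rewrite bt_ => bI; exact: res0 bI eb.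
  have toI : t \in `]a, b[ by rewrite in_itv /= !lt_neqAle eq_sym ta' ta tb' tb.
  have ne : \forall s \near t, g s = c 0 s.
    by apply: filterS (near_in_itvoo toI) => s /subset_itv_oo_cc /cg.
  have := near_euler_lagrange (sg t tI) ne (EL t tI).
  by move/(euler_lagrangeP L_smooth (hc t tI)) => r0; rewrite variation_densityE.
rewrite (@eq_Rintegral _ _ _ _ _ (fun=> 0)); first by rewrite Rintegral_cst // mul0r.
by move=> t; rewrite inE => /E0.
Qed.

(** The factor chi = (t - a) (b - t) <r, w> makes the density of the first variation
    nonnegative and makes the variation vanish at both ends. *)
Lemma euler_lagrange_of_stationary (g : R -> G) : smooth_curve a b g ->
  stationary L a b g ->
  forall t, t \in `[a, b] -> trivialized_euler_lagrange L g t.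
Proof.
move=> sg st.
have fam w chi : (forall t, t \in `[a, b] -> smooth_at chi t) ->
    smooth_family (translated_family g w chi).
  move=> schi t tI; apply: translated_family_smooth; [exact: sg|exact: schi].
have densE w chi t : (forall t, t \in `[a, b] -> smooth_at chi t) -> t \in `[a, b] ->
    variation_density (translated_family g w chi) t = chi t * residual L g t w.
  move=> schi tI; have hc := fam w chi schi.
  rewrite variation_densityE // translated_variation.
  by rewrite (residualZ L_smooth (hc t tI)) translated_family0.
have s1 t : t \in `[a, b] -> smooth_at (fun=> 1 : R^o) (t : R^o).
  by move=> _; exact: smooth_at_cst.
have key w t : t \in `[a, b] -> residual L g t w = 0.
  (* <r, w> as the density of a family with eta = w: this form is visibly smooth. *)
  pose F := variation_density (translated_family g w (fun=> 1)).
  have FE s : s \in `[a, b] -> F s = residual L g s w.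
    by move=> sI; rewrite /F densE // mul1r.
  have sF s : s \in `[a, b] -> smooth_at F s.
    by move=> sI; apply: variation_density_smooth => //; exact: fam.
  pose chi (s : R^o) : R^o := ((s - a) * (b - s)) * F s.
  have schi s : s \in `[a, b] -> smooth_at chi s.
    move=> sI; apply: (smooth_at_scale (k := fun s : R^o => (s - a) * (b - s))); last exact: sF.
    apply: (smooth_at_scale (k := fun s : R^o => s - a) (f := fun s : R^o => b - s)).
      by apply: smooth_at_sub; [exact: smooth_at_id|exact: smooth_at_cst].
    by apply: smooth_at_sub; [exact: smooth_at_cst|exact: smooth_at_id].
  pose c := translated_family g w chi.
  have hc : smooth_family c by exact: fam.
  have aI : a \in `[a, b] by rewrite in_itv /= lexx ltW.
  have bI : b \in `[a, b] by rewrite in_itv /= lexx ltW.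
  have chia : chi a = 0 by rewrite /chi subrr !mul0r.
  have chib : chi b = 0 by rewrite /chi subrr mulr0 mul0r.
  have var : is_variation a b g c.
    split=> // [s sI||]; first by rewrite /c translated_family0.
    - exact: translated_variation_field0.
    - exact: translated_variation_field0.
  have eta0 s : s \in `[a, b] -> chi s = 0 -> trivialized_variation c s = 0.
    by move=> sI c0; rewrite translated_variation c0 scale0r.
  have A := action_variation hc (eta0 _ aI chia) (eta0 _ bI chib).
  have I0 : (\int[mu]_(s in [set` `[a, b]]) (variation_density c s : R))%R = 0.
    by have [_ <-] := A; have [_] := st c var.
  have densk s : s \in `[a, b] -> variation_density c s = (s - a) * (b - s) * F s ^+ 2.
    by move=> sI; rewrite /c densE // -FE // /chi expr2 mulrA.
  have dens0 s : s \in `]a, b[ -> variation_density c s = 0.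
    apply: (@Rintegral_eq0 _ a b (variation_density c)) => // r rI.
      exact: smooth_at_continuous (variation_density_smooth hc rI).
    rewrite densk // mulr_ge0 ?sqr_ge0 //.
    by move: rI; rewrite in_itv /= => /andP [ra rb]; rewrite mulr_ge0 // subr_ge0.
  move=> tI; rewrite -FE //.
  have cF s : s \in `[a, b] -> {for s, continuous (F : R -> R)}.
    by move=> sI; exact: smooth_at_continuous (sF s sI).
  have F0 s : s \in `]a, b[ -> F s = 0.
    move=> sI; have := dens0 s sI; rewrite densk; last exact: subset_itv_oo_cc sI.
    move: sI; rewrite in_itv /= => /andP [sa sb].
    have n0 : (s - a) * (b - s) != 0 by rewrite mulf_neq0 // subr_eq0 gt_eqF.
    by move/eqP; rewrite mulf_eq0 (negbTE n0) /= sqrf_eq0 => /eqP.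
  exact: (continuous_eq0_closure ab cF F0).
move=> t tI; have hc := fam 0 _ s1 t tI.
have := euler_lagrangeP L_smooth hc; rewrite translated_family0 => -[_]; apply.
by move=> w; exact: key.
Qed.

End ActionVariation.

Theorem mainTheorem1 (R : realType) (E : completeNormedModType R)
    (G : lieGroupType E) (g_reflexive : reflexive_space (lie_algebra G))
    (L : G -> lie_algebra G -> R) (L_smooth : smooth_lagrangian L)
    (a b : R) (ab : a < b) (g : R -> G) (g_smooth : smooth_curve a b g) :
  stationary L a b g <->
  forall t, t \in `[a, b] -> trivialized_euler_lagrange L g t.
Proof.
split; first exact: euler_lagrange_of_stationary.
exact: stationary_of_euler_lagrange.
Qed.
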